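(* Assume that (H1)-(H2) hold. For all $g_0\in E^2(p,w)$ such that $g_0>0$, the sequence of intervals \begin{equation*} I_n=\left[\inf \frac{\widetilde{\mathcal{L}} ^{n+1} g_0}{\widetilde{\mathcal{L}} ^n g_0},\sup \frac{\widetilde{\mathcal{L}} ^{n+1} g_0}{\widetilde{\mathcal{L}} ^n g_0}\right] \end{equation*} satisfies $I_{n+1}\subset I_n$ for all $n\in\mathbb{N}$ and $C(p,w)\in \bigcap_{n\in\mathbb{N}}I_n$.
   Context: Let $-\infty\le a<b\le\infty$, let $p\in L^1(]a,b[)$ be a probability density with $p>0$ a.e. on $]a,b[$, and let $w\in L^1_{\text{loc}}(]a,b[)$ be a weight with $w>0$ a.e. and $pw\in L^1_{\text{loc}}(]a,b[)$. Let $P(x)=\int_a^x p$, $\bar P=1-P$, and $K(x,y)=P(x\wedge y)\bar P(x\vee y)$. $H^1(p,w)$ is the set of weakly differentiable $h\in L^2(p)$ with $h'\in L^2(pw)$, and $C(p,w)$ is the smallest constant $C$ with $\mathrm{Var}_p[h]\le C\,\mathbb{E}_p[|h'|^2w]$ for all $h\in H^1(p,w)$. Hypotheses: (H1) $C(p,w)<\infty$; (H2) $L^2(pw)\subset L^1_{\text{loc}}(]a,b[)$. $E^2(p,w)=\{f\in L^2(pw)\cap L^1_{\text{loc}}(]a,b[): x\mapsto \int_{x_0}^x f\in L^2(p)\}$ (any fixed $x_0\in]a,b[$), with the $L^2(pw)$ norm; under (H1)-(H2) it equals $L^2(pw)$. The pseudo-inverse Sturm-Liouville operator is $\widetilde{\mathcal{L}}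 f(x)=\frac{1}{p(x)w(x)}\int_a^b K(x,y)f(y)\,dy$, with iterates $\widetilde{\mathcal{L}}^0 f=f$, $\widetilde{\mathcal{L}}^{n+1}=\widetilde{\mathcal{L}}(\widetilde{\mathcal{L}}^n)$. $\inf,\sup$ denote essential infimum/supremum over $]a,b[$. *)

(* Defs.v *)
From HB Require Import structures.
From mathcomp Require Import all_boot all_order all_algebra.
From mathcomp Require Import all_classical all_reals all_analysis.
From mathcomp Require Import measurable_realfun ess_sup_inf.
Import Order.TTheory GRing.Theory Num.Theory numFieldNormedType.Exports.

Set Implicit Arguments.
Unset Strict Implicit.
Unset Printing Implicit Defensive.

Local Open Scope classical_set_scope.
Local Open Scope ring_scope.

Section defs.
Context {R : realType}.
Local Notation mu := (@lebesgue_measure R).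

Definition oitv (a b : \bar R) : set R := [set x : R | (a < x%:E < b)%E].

Lemma measurable_oitv (a b : \bar R) : measurable (oitv a b).
Proof.
have -> : oitv a b = setT `&` (@EFin R @^-1` `]a, b[%classic).
  by apply/seteqP; split => x /=; rewrite in_itv /= => //; case.
exact: (measurable_realfun.EFin_measurable measurableT (measurable_realfun.emeasurable_itv _)).
Qed.

Definition mu_on (a b : \bar R) := mrestr mu (measurable_oitv a b).

Definition Lloc1 (a b : \bar R) (f : R -> R) := locally_integrable (oitv a b) f.

Definition L2w (a b : \bar R) (u f : R -> R) :=
  measurable_fun (oitv a b) f /\
  (\int[mu]_(x in oitv a b) (u x * f x ^+ 2)%:E < +oo)%E.

Definition smooth (f : R -> R) := forall (n : nat) (x : R), derivable (derive1n n f) x 1.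
Definition test_fun (a b : \bar R) (phi : R -> R) :=
  smooth phi /\ exists c d : R, [/\ (a < c%:E)%E, (d%:E < b)%E &
     forall x, x < c \/ d < x -> phi x = 0].

Definition weak_deriv (a b : \bar R) (h g : R -> R) :=
  [/\ Lloc1 a b h, Lloc1 a b g &
   forall phi, test_fun a b phi ->
     \int[mu]_(x in oitv a b) (h x * derive1 phi x) =
     - \int[mu]_(x in oitv a b) (g x * phi x)].

Definition H1 (a b : \bar R) (p w h h' : R -> R) :=
  [/\ weak_deriv a b h h', L2w a b p h & L2w a b (fun x => p x * w x) h'].

Definition Ep (a b : \bar R) (p f : R -> R) := \int[mu]_(x in oitv a b) (p x * f x).
Definition Varp (a b : \bar R) (p h : R -> R) :=
  Ep a b p (fun x => h x ^+ 2) - (Ep a b p h) ^+ 2.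

(** C(p,w): the smallest constant in the weighted Poincare inequality
    (infimum of admissible constants; +oo if none). *)
Definition poincare_const (a b : \bar R) (p w : R -> R) : \bar R :=
  ereal_inf [set c%:E | c in [set c : R | forall h h', H1 a b p w h h' ->
      Varp a b p h <= c * Ep a b p (fun x => h' x ^+ 2 * w x)]].

Definition cdf (a b : \bar R) (p : R -> R) (x : R) :=
  \int[mu]_(y in oitv a b `&` `]-oo, x]) p y.
Definition kernelK (a b : \bar R) (p : R -> R) (x y : R) :=
  cdf a b p (Num.min x y) * (1 - cdf a b p (Num.max x y)).

(** Pseudo-inverse Sturm-Liouville operator and its iterates. *)
Definition Ltilde (a b : \bar R) (p w f : R -> R) (x : R) :=
  (p x * w x)^-1 * \int[mu]_(y in oitv a b) (kernelK a b p x y * f y).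
Definition Ltilde_iter (a b : \bar R) (p w : R -> R) (n : nat) (f : R -> R) :=
  iter n (Ltilde a b p w) f.

Definition prim (x0 : R) (f : R -> R) (x : R) :=
  if x0 <= x then \int[mu]_(y in `[x0, x]) f y
  else - \int[mu]_(y in `[x, x0]) f y.

Definition E2 (a b : \bar R) (p w : R -> R) (f : R -> R) :=
  exists x0 : R, [/\ (a < x0%:E < b)%E,
    L2w a b (fun x => p x * w x) f, Lloc1 a b f & L2w a b p (prim x0 f)].

Definition density_weight (a b : \bar R) (p w : R -> R) :=
  [/\ mu.-integrable (oitv a b) (EFin \o p),
      \int[mu]_(x in oitv a b) p x = 1
      & (\forall x \ae mu, oitv a b x -> 0 < p x)] /\
  [/\ Lloc1 a b w,
      (\forall x \ae mu, oitv a b x -> 0 < w x) &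
      Lloc1 a b (fun x => p x * w x)].

Definition hypH1 (a b : \bar R) (p w : R -> R) := (poincare_const a b p w < +oo)%E.
Definition hypH2 (a b : \bar R) (p w : R -> R) :=
  forall f, L2w a b (fun x => p x * w x) f -> Lloc1 a b f.

Definition ratio_itv (a b : \bar R) (p w g0 : R -> R) (n : nat) : set (\bar R) :=
  let q := fun x => (Ltilde_iter a b p w n.+1 g0 x / Ltilde_iter a b p w n g0 x)%:E in
  [set c | (ess_inf (mu_on a b) q <= c <= ess_sup (mu_on a b) q)%E].

End defs.

(* Main.v *)
Require Import Defs.
From HB Require Import structures.
From mathcomp Require Import all_boot all_order all_algebra.
From mathcomp Require Import all_classical all_reals all_analysis.
From mathcomp Require Import measurable_realfun ess_sup_inf.
From mathcomp Require Import ring lra.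
Import Order.TTheory GRing.Theory Num.Theory numFieldNormedType.Exports.
Local Open Scope classical_set_scope.
Local Open Scope ring_scope.

Set Implicit Arguments.
Unset Strict Implicit.
Unset Printing Implicit Defensive.

(** A weakly differentiable [h] satisfies [h y - h x = \int_x^y h'] for almost
    all [x < y].  Writing [Var h] as the double integral of
    [p x * p y * (h y - h x)^2] over [x < y], Tonelli's theorem gives Hoeffding's
    identity for [h' >= 0], and [Var h <= \int\int K |h'| |h'|] in general.  Since
    primitives of compactly supported functions may be tested in the Poincare
    inequality, a constant [c] is admissible exactly when
    [\int\int K f f <= c \int p w f^2] for all [f >= 0].
    Positivity of [K] propagates bounds [m g <= L g <= M g] from [g] to [L g].
    Integrating the lower one against [p w g] gives
    [m \int p w g^2 <= \int\int K g g <= c \int p w g^2], hence [m <= c];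
    the upper one makes [M] admissible, by Schur's test with weight [g]. *)

(** * Smooth step functions *)

(** The main obstacle is finiteness. [Ltilde] and [Varp] are built from real-valued integrals, which
    return 0 where the true integral is infinite, and nothing says beforehand that [Ltilde]
    preserves L^2(pw). The kernel form and the kernel operator are therefore kept in [0, +oo] and
    applied to nonnegative functions, where Tonelli's theorem and monotone convergence need no
    integrability. Any admissible constant c, which exists by (H1), then supplies the bounds. Tested
    on f, it makes the integral of f times K f finite, so K f is finite almost everywhere; tested on
    f plus a small multiple of a truncation of L f, it puts L f in L^2(pw). Hence positivity and
    finite energy pass to all iterates. (H2) makes a compactly supported function of finite energy
    integrable, so that it has a primitive to test. Weak derivatives are defined by smooth test
    functions, so the increment formula requires explicit smooth approximations of indicators; these
    are built from exp(-1/x). *)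

Section smooth_step.
Context {R : realType}.
Implicit Types (f g : R -> R) (n k : nat) (x : R).

(** Unlike [derive1n], which differentiates on the outside, the recursion differentiates the
    argument; closure under products and inverses is then an induction on [n] through the usual
    rules. *)
Fixpoint Cn n f : Prop :=
  if n is m.+1 then (forall x, derivable f x 1) /\ Cn m (derive1 f) else True.

Lemma Cn_derive1n n f : Cn n.+1 f -> forall x, derivable (derive1n n f) x 1.
Proof.
by elim: n f => [|n IH] f [df Cf] x; [exact: df|rewrite derive1Sn; exact: IH].
Qed.

Lemma smoothP f : (forall n, Cn n f) -> smooth f.
Proof. by move=> Cf n x; apply: Cn_derive1n. Qed.

Lemma CnW n f : Cn n.+1 f -> Cn n f.
Proof. by elim: n f => // n IH f [df Cf]; split=> //; exact: IH. Qed.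

Lemma CnS_is_derive n f f' : (forall x, is_derive x 1 f (f' x)) ->
  Cn n f' -> Cn n.+1 f.
Proof.
move=> df Cf'; split => [x|]; first by have [] := df x.
by rewrite (_ : derive1 f = f')//; apply/funext => x; rewrite derive1E; exact: derive_val.
Qed.

Lemma CnP n f : Cn n.+1 f -> exists2 f', (forall x, is_derive x 1 f (f' x)) & Cn n f'.
Proof.
move=> [df Cf]; exists (derive1 f) => // x.
by rewrite derive1E; apply/derivableP.
Qed.

Lemma Cn_cst n (c : R) : Cn n (cst c).
Proof.
elim: n c => // n IH c; apply: (@CnS_is_derive _ _ (cst 0)) (IH 0) => x.
Qed.

Lemma CnD n f g : Cn n f -> Cn n g -> Cn n (f \+ g).
Proof.
elim: n f g => // n IH f g /CnP[f' df Cf] /CnP[g' dg Cg].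
apply: (@CnS_is_derive _ _ (f' \+ g')) (IH _ _ Cf Cg) => x.
Qed.

Lemma CnM n f g : Cn n f -> Cn n g -> Cn n (f \* g).
Proof.
elim: n f g => // n IH f g Cf0 Cg0.
have [f' df Cf] := CnP Cf0; have [g' dg Cg] := CnP Cg0.
have C1 := IH _ _ (CnW Cf0) Cg; have C2 := IH _ _ (CnW Cg0) Cf.
apply: (@CnS_is_derive _ _ _ _ (CnD C1 C2)) => x.
Qed.

Lemma CnV n f : (forall x, f x != 0) -> Cn n f -> Cn n (fun x => (f x)^-1).
Proof.
move=> f0; elim: n => // n IH Cf0; have [f' df Cf] := CnP Cf0.
have C1 := IH (CnW Cf0).
apply: (@CnS_is_derive _ _ _ _ (CnM (CnM (CnM (Cn_cst n (-1)) C1) C1) Cf)) => x.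
apply: (is_derive_eq (is_deriveV (f0 x) (df x))).
by rewrite /= mulN1r expr2 invfM mulNr.
Qed.

Lemma Cn_affine n f (r s : R) : Cn n f -> Cn n (fun x => f (r * x + s)).
Proof.
elim: n f => // n IH f /CnP[f' df Cf].
apply: (@CnS_is_derive _ _ _ _ (CnM (Cn_cst n r) (IH _ Cf))) => x.
have da : is_derive x 1 (fun y : R => r * y + s) (r * 1 + 0).
  by apply: is_deriveD.
have := @is_derive1_comp _ f (fun y => r * y + s) x _ _ (df _) da.
by rewrite addr0 mulr1 mulrC.
Qed.

(** The functions x^(-k) exp(-1/x), extended by 0, span a space closed under differentiation, so
    their smoothness is one induction; [exp_inv 0] is the classical flat function. *)
Definition exp_inv k x := if 0 < x then x^-1 ^+ k * expR (- x^-1) else 0.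

(** With u = 1/x, this is the bound 1 + u^(k+1)/(k+1)! <= exp u. It makes every member of the family
    O(x) at 0+, which yields differentiability at the origin. *)
Lemma exp_inv_bound k x : 0 < x -> x^-1 ^+ k * expR (- x^-1) <= (k.+1)`!%:R * x.
Proof.
move=> x0; rewrite expRN ler_pdivrMr ?expR_gt0//.
have xi0 : 0 < x^-1 by rewrite invr_gt0.
have f0 : (0 < (k.+1)`!%:R :> R) by rewrite ltr0n fact_gt0.
have := expR_ge1Dxn k (ltW xi0).
have -> : x^-1 ^+ k = (k.+1)`!%:R * x * (x^-1 ^+ k.+1 / (k.+1)`!%:R).
  by rewrite exprS; field; rewrite !gt_eqF.
move=> H; rewrite ler_pM2l ?mulr_gt0//; lra.
Qed.

Lemma exp_inv0_ge0 x : 0 <= exp_inv 0 x.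
Proof. by rewrite /exp_inv; case: ifP => // _; rewrite expr0 mul1r expR_ge0. Qed.

Lemma exp_inv0_gt0 x : 0 < x -> 0 < exp_inv 0 x.
Proof. by move=> x0; rewrite /exp_inv x0 expr0 mul1r expR_gt0. Qed.

Lemma exp_inv_npos k x : x <= 0 -> exp_inv k x = 0.
Proof. by move=> x0; rewrite /exp_inv ltNge x0. Qed.

Lemma is_derive_exp_inv k x :
  is_derive x 1 (exp_inv k) (- k%:R * exp_inv k.+1 x + exp_inv k.+2 x).
Proof.
have [x0|x0|->] := ltgtP x 0.
- rewrite !exp_inv_npos ?ltW// mulr0 addr0.
  have H : {near x, cst 0 =1 exp_inv k}.
    by near=> y; rewrite exp_inv_npos// ltW//; near: y; exact: lt_nbhsl.
  split; first exact: near_eq_derivable H _.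
  by rewrite -(near_eq_derive _ H); exact: derive_cst.
- pose g (y : R) := y^-1 ^+ k * expR (- y^-1).
  have xn0 : x != 0 by rewrite gt_eqF.
  have H : {near x, g =1 exp_inv k}.
    by near=> y; rewrite /g /exp_inv ifT//; near: y; exact: lt_nbhsr.
  have dv : is_derive x 1 (fun y : R => y^-1) (- x ^- 2 *: 1).
    exact: (@is_deriveV _ id).
  have dg : is_derive x 1 g (- k%:R * exp_inv k.+1 x + exp_inv k.+2 x).
    have d1 : is_derive x 1 ((fun y : R => y^-1) ^+ k) _ := is_deriveX k dv.
    have d2 : is_derive x 1 (fun y => expR (- y^-1)) _ :=
      @is_derive1_comp _ expR (fun y => - y^-1) x _ _ (is_derive_expR _) (is_deriveN dv).
    have := is_deriveM d1 d2.
    have -> : ((fun y : R => y^-1) ^+ k : R -> R) * (fun y : R => expR (- y^-1)) = g.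
      by apply/funext => y; rewrite /g mulrfctE exprfctE.
    move=> /is_derive_eq; apply; rewrite /= /exp_inv x0 fctE /GRing.scale/=.
    case: (k) => [|m]; last by rewrite -mulr_natl/= !exprS; field.
    by rewrite !mulr0n oppr0 !mul0r add0r expr0 !mul1r mulr1 !opprK; field.
  split; first by apply: near_eq_derivable H _; have [] := dg.
  by rewrite -(near_eq_derive _ H); exact: derive_val.
(* At the origin the difference quotient of [exp_inv k] is [exp_inv k.+1], which is at most (k+2)! h
   for h > 0 and vanishes for h < 0. *)
- rewrite !exp_inv_npos// mulr0 addr0.
  have H : h^-1 *: ((exp_inv k \o shift 0) (h *: 1) - exp_inv k 0) @[h --> 0^'] --> (0 : R).
    apply/cvgr0Pnorm_le => e e0.
    pose M : R := (k.+2)`!%:R.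
    have M0 : 0 < M by rewrite ltr0n fact_gt0.
    near=> h.
    rewrite (exp_inv_npos k (lexx 0)) subr0 /= addr0 /GRing.scale/= mulr1.
    have [h0|h0] := ltP 0 h; last by rewrite exp_inv_npos// mulr0 normr0 ltW.
    rewrite /exp_inv h0 mulrA -exprS ger0_norm; last first.
      by rewrite mulr_ge0 ?expR_ge0// exprn_ge0// invr_ge0 ltW.
    apply: (le_trans (exp_inv_bound k.+1 h0)).
    rewrite -/M mulrC -ler_pdivlMr//; apply: (le_trans (ler_norm h)).
    near: h; apply: dnbhs0_le; exact: divr_gt0.
  split; first by apply/cvg_ex; exists 0.
  exact: cvg_lim H.
Unshelve. all: by end_near. Qed.

Lemma Cn_exp_inv n k : Cn n (exp_inv k).
Proof.
elim: n k => // n IH k.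
apply: (CnS_is_derive (is_derive_exp_inv k)).
exact: CnD (CnM (Cn_cst n _) (IH _)) (IH _).
Qed.

(** The denominator never vanishes, since x and 1 - x are not both nonpositive. The quotient is
    locally constant off [0, 1], so its derivative lives there. *)
Definition smooth_step x := exp_inv 0 x / (exp_inv 0 x + exp_inv 0 (1 - x)).

Lemma smooth_step_den x : 0 < exp_inv 0 x + exp_inv 0 (1 - x).
Proof.
have [x0|x0] := ltP 0 x; first by rewrite ltr_pwDl ?exp_inv0_gt0 ?exp_inv0_ge0.
by rewrite ltr_wpDl ?exp_inv0_ge0// exp_inv0_gt0//; lra.
Qed.

Lemma Cn_smooth_step n : Cn n smooth_step.
Proof.
apply: (CnM (Cn_exp_inv n 0)); apply: CnV.
  by move=> x; rewrite gt_eqF ?smooth_step_den.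
apply: (CnD (Cn_exp_inv n 0)).
have := Cn_affine (-1) 1 (Cn_exp_inv n 0).
by congr Cn; apply/funext => x; rewrite mulN1r addrC.
Qed.

Lemma smooth_step_le0 x : x <= 0 -> smooth_step x = 0.
Proof. by move=> x0; rewrite /smooth_step exp_inv_npos// mul0r. Qed.

Lemma smooth_step_ge1 x : 1 <= x -> smooth_step x = 1.
Proof.
move=> x1; rewrite /smooth_step (@exp_inv_npos 0 (1 - x)) ?subr_le0// addr0.
by rewrite divff// gt_eqF// exp_inv0_gt0// (lt_le_trans ltr01).
Qed.

Lemma smooth_step01 x : 0 <= smooth_step x <= 1.
Proof.
rewrite /smooth_step ler_pdivrMr ?smooth_step_den// mul1r lerDl exp_inv0_ge0.
by rewrite divr_ge0 ?exp_inv0_ge0// ltW ?smooth_step_den.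
Qed.

Lemma derivable_smooth_step x : derivable smooth_step x 1.
Proof. by have [] := Cn_smooth_step 1. Qed.

Lemma continuous_derive1_smooth_step : continuous (derive1 smooth_step).
Proof.
move=> x; apply/differentiable_continuous/derivable1_diffP.
by have [_ []] := Cn_smooth_step 2.
Qed.

Lemma derive1_smooth_step_lt0 x : x < 0 -> derive1 smooth_step x = 0.
Proof.
move=> x0; rewrite derive1E (@near_eq_derive _ _ _ _ (cst 0)) ?derive_cst//.
by near=> y; rewrite smooth_step_le0// ltW//; near: y; exact: lt_nbhsl.
Unshelve. all: by end_near. Qed.

Lemma derive1_smooth_step_gt1 x : 1 < x -> derive1 smooth_step x = 0.
Proof.
move=> x0; rewrite derive1E (@near_eq_derive _ _ _ _ (cst (1:R))) ?derive_cst//.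
by near=> y; rewrite smooth_step_ge1// ltW//; near: y; exact: lt_nbhsr.
Unshelve. all: by end_near. Qed.

Lemma derive1_smooth_step_bounded : exists2 M, 0 <= M &
  forall x, `|derive1 smooth_step x| <= M.
Proof.
have [|c _ Hc] := @EVT_max R (fun x => `|derive1 smooth_step x|) 0 1 ler01.
  apply: continuous_subspaceT => x; apply: continuous_comp.
    exact: continuous_derive1_smooth_step.
  exact: norm_continuous.
exists `|derive1 smooth_step c| => // x.
have [x0|x0] := ltP x 0; first by rewrite derive1_smooth_step_lt0// normr0.
have [x1|x1] := ltP 1 x; first by rewrite derive1_smooth_step_gt1// normr0.
by apply: Hc; rewrite in_itv/= x0 x1.
Qed.
End smooth_step.

(** * Increments of weakly differentiable functions *)

Section weak_primitive.
Context {R : realType}.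
Implicit Types (a b : \bar R) (f g h F : R -> R) (x y : R) (n k : nat).
Local Notation mu := (@lebesgue_measure R).

(** With [hi], endpoints of compact intervals exhausting ]a, b[. For small [n] the interval may be
    empty, which does no harm since every point of ]a, b[ is eventually inside. *)
Definition lo a n : R := if a is r%:E then r + n.+1%:R^-1 else - n%:R.
Definition hi b n : R := if b is r%:E then r - n.+1%:R^-1 else n%:R.

Lemma lt_lo a b n : (a < b)%E -> (a < (lo a n)%:E)%E.
Proof.
case: a => [r _||_] /=; last by rewrite ltNyr.
  by rewrite lte_fin ltrDl invr_gt0.
by case: b.
Qed.

Lemma gt_hi a b n : (a < b)%E -> ((hi b n)%:E < b)%E.
Proof.
case: b => [r _|_|] /=; first by rewrite lte_fin gtrDl oppr_lt0 invr_gt0.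
  by rewrite ltry.
by case: a.
Qed.

Lemma lo_nincr a n m : (n <= m)%N -> lo a m <= lo a n.
Proof.
move=> nm; case: a => [r||] /=; rewrite ?lerN2 ?ler_nat//.
by rewrite lerD2l lef_pV2 ?posrE// ler_nat.
Qed.

Lemma hi_ndecr b n m : (n <= m)%N -> hi b n <= hi b m.
Proof.
move=> nm; case: b => [r||] /=; rewrite ?ler_nat//.
by rewrite lerD2l lerN2 lef_pV2 ?posrE// ler_nat.
Qed.

Lemma near_lo_hi a b x : oitv a b x -> \forall n \near \oo, lo a n < x < hi b n.
Proof.
move=> /andP[ax xb].
suff : (\forall n \near \oo, lo a n < x) /\ (\forall n \near \oo, x < hi b n).
  by move=> [? ?]; near=> n; apply/andP; split; near: n.
split.
- case: a ax => [r|//|] /=.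
  + rewrite lte_fin -subr_gt0 => rx.
    near=> n; rewrite -ltrBrDl.
    by near: n; exact: near_infty_natSinv_lt (PosNum rx).
  + move=> _; near=> n; rewrite ltrNl; near: n; exact: nbhs_infty_gtr.
- case: b xb => [r||//] /=.
  + rewrite lte_fin -subr_gt0 => rx.
    near=> n; rewrite ltrBrDl -ltrBrDr.
    by near: n; exact: near_infty_natSinv_lt (PosNum rx).
  + move=> _; near=> n; near: n; exact: nbhs_infty_gtr.
Unshelve. all: by end_near. Qed.

Lemma itvcc_oitv a b (c d : R) : (a < c%:E)%E -> (d%:E < b)%E -> `[c, d] `<=` oitv a b.
Proof.
move=> ac db z /=; rewrite in_itv/= => /andP[cz zd].
by rewrite /oitv/= (lt_le_trans ac) ?lee_fin//= (le_lt_trans _ db) ?lee_fin.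
Qed.

Lemma Lloc1_integrable a b f (c d : R) : Lloc1 a b f ->
  (a < c%:E)%E -> (d%:E < b)%E -> mu.-integrable `[c, d] (EFin \o f).
Proof.
move=> [mf oD fK] ac db; apply/integrableP; split.
  apply/measurable_EFinP; apply: measurable_funS mf; first exact: measurable_oitv.
  exact: itvcc_oitv.
by apply: fK; [exact: itvcc_oitv|exact: segment_compact].
Qed.

(** Derivative of a rescaled step: a one-sided approximate identity of mass 1, supported in
    [[x, x + 1/(k+1)]], of height O(k). *)
Definition approx_dirac x k (z : R) := k.+1%:R * derive1 smooth_step (k.+1%:R * (z - x)) : R.

Lemma is_derive_step x k (z : R) :
  is_derive z (1 : R) (fun y => smooth_step (k.+1%:R * (y - x))) (approx_dirac x k z).
Proof.
have da : is_derive z 1 (fun y : R => k.+1%:R * (y - x)) (k.+1%:R * (1 - 0)).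
  exact: is_deriveZ.
have ds : is_derive (k.+1%:R * (z - x)) 1 smooth_step
    (derive1 smooth_step (k.+1%:R * (z - x))).
  by rewrite derive1E; apply/derivableP; exact: derivable_smooth_step.
have := @is_derive1_comp _ smooth_step (fun y => k.+1%:R * (y - x)) z _ _ ds da.
by rewrite subr0 mulr1 mulrC.
Qed.

Lemma continuous_approx_dirac x k : continuous (approx_dirac x k).
Proof.
move=> z; apply: cvgM; first exact: cvg_cst.
apply: (@continuous_comp _ _ _ (fun z => k.+1%:R * (z - x)) (derive1 smooth_step)).
  apply: cvgM; first exact: cvg_cst.
  by apply: cvgB; [exact: cvg_id|exact: cvg_cst].
exact: continuous_derive1_smooth_step.
Qed.

Lemma approx_dirac_out x k z : ~ (`[x, x + k.+1%:R^-1]%classic z) -> approx_dirac x k z = 0.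
Proof.
rewrite /= in_itv/= => /negP; rewrite negb_and -!ltNge /approx_dirac => /orP[zx|zx].
  rewrite derive1_smooth_step_lt0 ?mulr0//.
  by rewrite pmulr_rlt0// subr_lt0.
rewrite derive1_smooth_step_gt1 ?mulr0//.
by rewrite mulrC -ltr_pdivrMr// div1r ltrBrDl.
Qed.

Lemma integral_approx_dirac x k :
  \int[mu]_(z in `[x, x + k.+1%:R^-1]) approx_dirac x k z = 1.
Proof.
rewrite /Rintegral (@continuous_FTC2 _ _ (fun y => smooth_step (k.+1%:R * (y - x)))).
- rewrite subrr mulr0 addrAC subrr add0r mulfV ?pnatr_eq0//.
  by rewrite (smooth_step_le0 (lexx 0)) (smooth_step_ge1 (lexx 1)) -EFinB/= subr0.
- by rewrite ltrDl invr_gt0.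
- exact/continuous_subspaceT/continuous_approx_dirac.
- have dd z : derivable (fun y => smooth_step (k.+1%:R * (y - x))) z 1.
    by have [] := is_derive_step x k z.
  have cc z : {for z, continuous (fun y => smooth_step (k.+1%:R * (y - x)))}.
    exact/differentiable_continuous/derivable1_diffP.
  split => [z _//||].
    exact/cvg_at_right_filter/cc.
  exact/cvg_at_left_filter/cc.
- move=> z _; rewrite derive1E; by have [_ ->] := is_derive_step x k z.
Qed.

Lemma measurable_approx_dirac (D : set R) x k : measurable D ->
  measurable_fun D (approx_dirac x k).
Proof.
move=> mD; apply: measurable_funTS; apply: continuous_measurable_fun.
exact: continuous_approx_dirac.
Qed.

Lemma approx_dirac_bounded : exists2 M : R, 0 <= M &
  forall x k z, `|approx_dirac x k z| <= k.+1%:R * M.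
Proof.
have [M M0 HM] := @derive1_smooth_step_bounded R; exists M => // x k z.
by rewrite normrM ger0_norm// ler_wpM2l.
Qed.

Lemma integrable_approx_diracM F (D : set R) x k : measurable D ->
  mu.-integrable D (EFin \o F) ->
  mu.-integrable D (EFin \o (fun z => F z * approx_dirac x k z)).
Proof.
move=> mD iF; have [M M0 HM] := approx_dirac_bounded.
have := @integrableMl _ _ _ mu D mD (EFin \o F) (approx_dirac x k) iF
  (measurable_approx_dirac x k mD).
apply; exists (k.+1%:R * M); split; first exact: num_real.
by move=> y My z _; exact: le_trans (HM _ _ _) (ltW My).
Qed.

(** Because the mass is 1, the error is the integral of F - F x against the kernel. It is at most
    the height times the integral of |F - F x| over a shrinking ball, that is, a constant times
    [davg], which tends to 0 at a Lebesgue point. *)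
Lemma lebesgue_pt_approx_dirac F x : locally_integrable setT F -> lebesgue_pt F x ->
  \int[mu]_(z in `[x, x + k.+1%:R^-1]) (F z * approx_dirac x k z) @[k --> \oo] --> F x.
Proof.
move=> lF ptF; have [M M0 HM] := approx_dirac_bounded.
pose D k := `[x, x + k.+1%:R^-1]%classic.
have iF k : mu.-integrable (D k) (EFin \o F).
  apply/integrableP; split.
    by apply/measurable_EFinP; apply: measurable_funTS; have [] := lF.
  by have [_ _] := lF; apply => //; exact: segment_compact.
(* The factor 2 puts the closed interval [D k] inside the open ball. The ball has length 4/(k+1),
   which against the height (k+1) M gives the constant 4 M. *)
pose r k : R := 2 * k.+1%:R^-1.
have r0 k : 0 < r k by rewrite mulr_gt0// invr_gt0.
have Hr : r k @[k --> \oo] --> 0.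
  by rewrite -[X in _ --> X](mulr0 2); apply: cvgMr; exact: cvg_harmonic.
have Hd : ((4 * M)%:E * davg F x (r k))%E @[k --> \oo] --> 0%E.
  rewrite -[X in _ --> X](mule0 (4 * M)%:E).
  apply: cvgeZl => //.
  exact: (cvge_at_rightP (davg F x) 0 0).1 ptF r (conj r0 Hr).
have Hle k : (`|(\int[mu]_(z in D k) (F z * approx_dirac x k z)) - F x|%:E <=
    (4 * M)%:E * davg F x (r k))%E.
  have mD : measurable (D k) by exact: measurable_itv.
  have iD : mu.-integrable (D k) (EFin \o approx_dirac x k).
    apply: continuous_compact_integrable; first exact: segment_compact.
    exact/continuous_subspaceT/continuous_approx_dirac.
  have iFx : mu.-integrable (D k) (EFin \o cst (F x)).
    apply: continuous_compact_integrable; first exact: segment_compact.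
    by apply/continuous_subspaceT => ?; exact: cvg_cst.
  have iB : mu.-integrable (D k) (EFin \o (fun z => F z - F x)).
    rewrite (_ : EFin \o _ = ((EFin \o F) \- (EFin \o cst (F x)))%E)//.
    exact: integrableB.
  have -> : \int[mu]_(z in D k) (F z * approx_dirac x k z) - F x =
      \int[mu]_(z in D k) ((F z - F x) * approx_dirac x k z).
    rewrite -[in LHS](mulr1 (F x)) -(integral_approx_dirac x k) -RintegralZl//.
    rewrite -RintegralB//; last 2 first.
      exact: integrable_approx_diracM.
      exact: (integrable_approx_diracM _ _ mD iFx).
    by apply: eq_Rintegral => z _; rewrite mulrBl.
  have iBd := integrable_approx_diracM x k mD iB.
  rewrite EFin_normr_Rintegral//.
  have /integrableP[mB _] := iB; have /integrableP[mBd _] := iBd.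
  apply: le_trans (le_abse_integral _ _ _) _ => //.
  have mF : measurable_fun setT F by have [] := lF.
  have mBT : measurable_fun setT (fun z => F z - F x) by exact: measurable_funB.
  apply: (@le_trans _ _ (\int[mu]_(z in ball x (r k)) ((k.+1%:R * M)%:E * `|(F z - F x)%:E|))%E).
    apply: (@le_trans _ _ (\int[mu]_(z in D k) ((k.+1%:R * M)%:E * `|(F z - F x)%:E|))%E).
      apply: ge0_le_integral => //.
      - exact: measurableT_comp.
      - apply: measurable_funeM; apply: measurableT_comp => //.
      - move=> z _; rewrite /= lee_fin normrM mulrC ler_wpM2r//.
    apply: ge0_subset_integral => //.
    - exact: measurable_ball.
    - by apply: measurable_funeM; apply: measurableT_comp => //;
        apply/measurable_EFinP/measurable_funTS.
    - by move=> z _; rewrite mule_ge0// lee_fin mulr_ge0.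
    - move=> z; rewrite /D/= in_itv/= /ball/= => /andP[xz zx].
      rewrite ltr_distlC; apply/andP; split.
        by rewrite (lt_le_trans _ xz)// gtrDl oppr_lt0.
      by rewrite (le_lt_trans zx)// ltrD2l /r ltr_pMl ?invr_gt0// ltr1n.
  rewrite ge0_integralZl//; last 3 first.
  - exact: measurable_ball.
  - by apply: measurableT_comp => //; apply/measurable_EFinP/measurable_funTS.
  - by rewrite lee_fin mulr_ge0.
  rewrite /davg /iavg (lebesgue_measure_ball _ (ltW (r0 k))) inver mulrn_eq0/= gt_eqF//.
  rewrite muleA -EFinM le_eqVlt; apply/orP; left; apply/eqP; congr (_%:E * _)%E.
  by rewrite /r; field; rewrite -?natr1 ?pnatr_eq0.
apply/cvgrPdist_le; rewrite /= => e e0.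
have /fine_cvgP[Hfin] : ((4 * M)%:E * davg F x (r k))%E @[k --> \oo] --> (0:R)%:E by [].
move=> /cvgrPdist_le/(_ e e0) He.
near=> k.
rewrite distrC -lee_fin; apply: (le_trans (Hle k)).
rewrite -[leLHS]fineK; last by near: k.
rewrite lee_fin; apply: (le_trans (ler_norm _)).
rewrite -normrN -sub0r; near: k; exact: He.
Unshelve. all: by end_near. Qed.

Definition plateau x y k (z : R) :=
  smooth_step (k.+1%:R * (z - x)) - smooth_step (k.+1%:R * (z - y)).

Lemma derive1_plateau x y k : derive1 (plateau x y k) =
  (fun z => approx_dirac x k z - approx_dirac y k z).
Proof.
apply/funext => z; rewrite derive1E.
by have [_ ->] := is_deriveB (is_derive_step x k z) (is_derive_step y k z).
Qed.

Lemma plateau_out x y k z : x < y -> z < x \/ y + k.+1%:R^-1 < z ->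
  plateau x y k z = 0.
Proof.
move=> xy [zx|zy]; rewrite /plateau.
  rewrite !smooth_step_le0 ?subrr// pmulr_rle0// subr_le0; first exact/ltW/(lt_trans zx).
  exact: ltW.
have zy' : 1 <= k.+1%:R * (z - y).
  by rewrite mulrC -ler_pdivrMr// div1r lerBrDl ltW.
rewrite !smooth_step_ge1 ?subrr//; apply: (le_trans zy').
by rewrite ler_pM2l// lerD2l lerN2 ltW.
Qed.

Lemma derivable_plateau x y k z : derivable (plateau x y k) z 1.
Proof. by have [] := is_deriveB (is_derive_step x k z) (is_derive_step y k z). Qed.

Lemma test_fun_plateau a b x y k : (a < x%:E)%E -> x < y ->
  ((y + k.+1%:R^-1)%:E < b)%E -> test_fun a b (plateau x y k).
Proof.
move=> ax xy yb; split; last first.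
  by exists x, (y + k.+1%:R^-1); split => // z; exact: plateau_out.
apply: smoothP => n.
have C t : Cn n (fun z : R => smooth_step (k.+1%:R * (z - t)) : R).
  have := Cn_affine k.+1%:R (- (k.+1%:R * t)) (@Cn_smooth_step R n).
  by congr Cn; apply/funext => z; rewrite mulrBr.
have := CnD (C x) (CnM (Cn_cst n (-1)) (C y)).
by congr Cn; apply/funext => z; rewrite /= mulN1r.
Qed.

Lemma near_plateau x y z : x < y ->
  \forall k \near \oo, plateau x y k z = \1_(`]x, y]) z.
Proof.
have H t : \forall k \near \oo, smooth_step (k.+1%:R * (z - t)) = (t < z)%R%:R :> R.
  have [tz|zt] := ltP t z; last first.
    by near=> k; rewrite smooth_step_le0// pmulr_rle0// subr_le0.
  near=> k; rewrite smooth_step_ge1//.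
  rewrite -ler_pdivrMr ?subr_gt0// div1r.
  rewrite (@le_trans _ _ k%:R)// ?ler_nat//.
  by near: k; exact: nbhs_infty_ger.
move=> xy; near=> k; rewrite /plateau indicE.
have -> : smooth_step (k.+1%:R * (z - x)) = (x < z)%R%:R by near: k.
have -> : smooth_step (k.+1%:R * (z - y)) = (y < z)%R%:R by near: k.
rewrite mem_setE/= in_itv/= leNgt.
have [yz|zy] := ltP y z; last by rewrite andbT subr0.
by rewrite (lt_trans xy yz) andbF subrr.
Unshelve. all: by end_near. Qed.

Lemma normr_plateau_le x y k z : `|plateau x y k z| <= 1.
Proof.
rewrite /plateau ler_norml.
have /andP[] := smooth_step01 (k.+1%:R * (z - x)).
have /andP[] := smooth_step01 (k.+1%:R * (z - y)).
lra.
Qed.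

(* The plateau functions are smooth approximations of the indicator of ]x, y],
   whose derivative concentrates at x and y. *)
Lemma weak_deriv_increment a b h h' : (a < b)%E -> weak_deriv a b h h' ->
  exists2 G : set R, {ae mu, forall x, G x} &
    forall x y, oitv a b x -> oitv a b y -> G x -> G y -> x < y ->
      \int[mu]_(z in `[x, y[) h' z = h y - h x.
Proof.
move=> ab [lh lh' wd].
(* [h] is locally integrable only inside ]a, b[, so Lebesgue differentiation is applied to its
   restrictions to countably many compact intervals; the exceptional set is the union of theirs. *)
pose J n := `[lo a n, hi b n]%classic.
have JO n : J n `<=` oitv a b by apply: itvcc_oitv; [exact: lt_lo ab|exact: gt_hi ab].
have iJ n : mu.-integrable (J n) (EFin \o h).
  by apply: Lloc1_integrable lh _ _; [exact: lt_lo ab|exact: gt_hi ab].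
have lJ n : locally_integrable setT (h \_ (J n)).
  by apply: integrable_locally_restrict; [exact: measurable_itv|exact: iJ].
exists [set x | forall n, lebesgue_pt (h \_ (J n)) x].
  by apply/ae_foralln => n; exact: lebesgue_differentiation.
move=> x y ox oy Gx Gy xy.
have /andP[ax xb] := ox; have /andP[ay yb] := oy.
near \oo => n.
have /andP[lx xh] : lo a n < x < hi b n by near: n; exact: near_lo_hi.
have /andP[ly yh] : lo a n < y < hi b n by near: n; exact: near_lo_hi.
pose d := hi b n.
have db : (d%:E < b)%E by exact: gt_hi ab.
have Hk : \forall k \near \oo, y + k.+1%:R^-1 < d.
  have : 0 < d - y by rewrite subr_gt0.
  move=> dy; near=> k; rewrite -ltrBrDl.
  by near: k; exact: near_infty_natSinv_lt (PosNum dy).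
have mO := @measurable_oitv R a b.
have mh' : measurable_fun (oitv a b) h' by have [] := lh'.
have ih' : mu.-integrable `[x, d] (EFin \o h') by exact: Lloc1_integrable lh' _ _.
(* Against [h'] the plateaus converge, dominated by |h'|, to the indicator of ]x, y]; passing to [x,
   y[ only moves null endpoints. *)
have L1 : \int[mu]_(z in `[x, d]) (h' z * plateau x y k z) @[k --> \oo] -->
    \int[mu]_(z in `[x, y[) h' z.
  have -> : \int[mu]_(z in `[x, y[) h' z = \int[mu]_(z in `[x, d]) (h' z * \1_(`]x, y]) z).
    rewrite Rintegral_itv_bndo_bndc; last first.
      apply: integrableS ih' => // z/=; rewrite !in_itv/= => /andP[-> zy]/=.
      by rewrite ltW// (lt_trans zy).
    rewrite -Rintegral_itv_obnd_cbnd; last first.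
      apply: integrableS ih' => // z/=; rewrite !in_itv/= => /andP[/ltW-> zy]/=.
      by rewrite ltW// (le_lt_trans zy).
    rewrite [LHS]Rintegral_mkcond [RHS]Rintegral_mkcond.
    apply: eq_Rintegral => z _; rewrite !patchE indicE.
    case: ifPn => z1; last by case: ifPn; rewrite ?mulr0.
    rewrite mulr1 ifT//; move: z1; rewrite !mem_setE !in_itv/= => /andP[/ltW-> zy]/=.
    by rewrite ltW// (le_lt_trans zy).
  have mpl k : measurable_fun `[x, d] (plateau x y k).
    apply: measurable_funTS; apply: continuous_measurable_fun => z.
    exact/differentiable_continuous/derivable1_diffP/derivable_plateau.
  have /integrableP[mh'd _] := ih'.
  have mh'd' : measurable_fun `[x, d] h' by exact/measurable_EFinP.
  have iabs : mu.-integrable `[x, d] (fun z => `|(h' z)%:E|)%E by exact: integrable_abse.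
  have m1 k : measurable_fun `[x, d] (fun z => (h' z * plateau x y k z)%:E).
    by apply/measurable_EFinP; exact: measurable_funM.
  have ind : mu.-integrable `[x, d] (fun z => (h' z * \1_(`]x, y]) z)%:E).
    apply: le_integrable iabs => //.
      by apply/measurable_EFinP; exact: measurable_funM.
    move=> z _; rewrite /= lee_fin normrM normr_id ler_piMr// indicE.
    by case: (_ \in _); rewrite ?normr1 ?normr0.
  apply: fine_cvg; rewrite fineK; last exact: integrable_fin_num.
  apply: (@dominated_cvg _ _ _ mu `[x, d] _ _ _ (fun z => `|(h' z)%:E|)%E) => //.
  - move=> z _; apply: cvg_near_cst; near=> k.
    rewrite (_ : plateau x y k z = \1_(`]x, y]) z)//.
    by near: k; exact: near_plateau.
  - move=> k z _; rewrite /= lee_fin normrM ler_piMr//.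
    exact: normr_plateau_le.
(* Against [h] the derivative of the plateau is a difference of two approximate identities, at [x]
   and at [y], whose limits are read off at Lebesgue points. *)
have L2 : (- \int[mu]_(z in oitv a b) (h z * derive1 (plateau x y k) z)) @[k --> \oo] -->
    h y - h x.
  pose F := h \_ (J n).
  have FE t : lo a n < t -> t < hi b n -> F t = h t.
    by move=> lt th; rewrite /F patchE ifT// mem_setE in_itv/= !ltW.
  rewrite -(FE _ lx xh) -(FE _ ly yh).
  have H : (\int[mu]_(z in `[y, y + k.+1%:R^-1]) (F z * approx_dirac y k z) -
            \int[mu]_(z in `[x, x + k.+1%:R^-1]) (F z * approx_dirac x k z))
      @[k --> \oo] --> F y - F x.
    exact: cvgB (lebesgue_pt_approx_dirac (lJ n) (Gy n))
      (lebesgue_pt_approx_dirac (lJ n) (Gx n)).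
  apply: cvg_trans H; apply: near_eq_cvg; near=> k.
  have kd : y + k.+1%:R^-1 < d by near: k.
  have DJ t z : x <= t -> t <= y -> z \in `[t, t + k.+1%:R^-1]%classic -> z \in J n.
    move=> xt ty; rewrite !mem_setE !in_itv/= => /andP[tz zt].
    rewrite (ltW (lt_le_trans lx (le_trans xt tz)))/=.
    by apply/ltW/(le_lt_trans zt)/(le_lt_trans _ kd); rewrite lerD2r.
  have iD t : x <= t -> t <= y -> mu.-integrable setT
      (EFin \o ((fun z => F z * approx_dirac t k z) \_ `[t, t + k.+1%:R^-1])).
    move=> xt ty; rewrite -restrict_EFin; apply: (integrable_mkcond _ _).1 => //.
    apply: integrable_approx_diracM => //.
    have -> : EFin \o F = (EFin \o h) \_ (J n) by rewrite restrict_EFin.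
    have mJ : measurable (J n) by exact: measurable_itv.
    apply: (@integrable_restrict _ _ _ mu _ mJ _ (measurable_itv _) _).1 => //.
    by apply: integrableS (iJ n) => //; exact: measurableI.
  suff -> : \int[mu]_(z in oitv a b) (h z * derive1 (plateau x y k) z) =
      \int[mu]_(z in `[x, x + k.+1%:R^-1]) (F z * approx_dirac x k z) -
      \int[mu]_(z in `[y, y + k.+1%:R^-1]) (F z * approx_dirac y k z) by rewrite opprB.
  rewrite [LHS]Rintegral_mkcond [X in X - _]Rintegral_mkcond [X in _ - X]Rintegral_mkcond.
  rewrite -RintegralB//; [|by apply: iD => //; exact: ltW..].
  have E t z : x <= t -> t <= y -> oitv a b z ->
      ((fun z => F z * approx_dirac t k z) \_ `[t, t + k.+1%:R^-1]) z =
      h z * approx_dirac t k z.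
    move=> xt ty oz; rewrite patchE; case: ifPn => zt.
      by rewrite /F patchE (DJ t).
    rewrite approx_dirac_out ?mulr0// => zt'.
    by move: zt; rewrite notin_setE; apply.
  have E0 t z : x <= t -> t <= y -> ~ oitv a b z ->
      ((fun z => F z * approx_dirac t k z) \_ `[t, t + k.+1%:R^-1]) z = 0.
    move=> xt ty oz; rewrite patchE; case: ifPn => // zt; exfalso; apply: oz.
    by apply: (JO n); apply/set_mem/(DJ t).
  apply: eq_Rintegral => z _; rewrite patchE derive1_plateau.
  case: ifPn => [/set_mem oz|]; last first.
    by rewrite notin_setE => oz; rewrite (E0 x z) ?(E0 y z) ?subrr// ltW.
  by rewrite (E x z) ?(E y z) ?mulrBr// ltW.
apply: (cvg_unique _ L1).
  exact: Rhausdorff.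
apply: cvg_trans L2; apply: near_eq_cvg; near=> k.
rewrite wd; last first.
  apply: test_fun_plateau => //; apply: lt_trans db; rewrite lte_fin.
  by near: k.
rewrite opprK [LHS]Rintegral_mkcond [RHS]Rintegral_mkcond.
apply: eq_Rintegral => z _; rewrite !patchE; have [zx|zx] := boolP (z \in `[x, d]%classic).
  by rewrite mem_set//; apply: (@itvcc_oitv a b x d) => //; exact: set_mem.
case: ifPn => // _; rewrite plateau_out ?mulr0//.
move: zx; rewrite mem_setE in_itv/= negb_and -!ltNge => /orP[|dz]; first by left.
by right; apply: lt_trans dz; near: k.
Unshelve. all: by end_near. Qed.

End weak_primitive.

(** * Weak differentiability of primitives *)

Lemma measurable_fun_bool_nat d (T : measurableType d) (R : realType) (P : T -> bool) :
  measurable_fun setT P -> measurable_fun setT (fun t => (P t)%:R : R).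
Proof.
move=> mP; rewrite (_ : (fun _ => _) = fun t => if P t then 1 else 0); last first.
  by apply/funext => t; case: (P t).
by apply: measurable_fun_if => //; exact: measurable_cst.
Qed.

Section primitive_weak_deriv.
Context {R : realType}.
Implicit Types (a b : \bar R) (f g h F phi : R -> R) (x y : R) (n k : nat).
Local Notation mu := (@lebesgue_measure R).

(** The open half-line makes increments integrals over [x, y[, the same convention as in
    [weak_deriv_increment] and [hoeffding]. *)
Definition primitive f x := \int[mu]_(z in `]-oo, x[) f z.

Section test_functions.
Variables (a b : \bar R) (phi : R -> R).
Hypothesis tphi : test_fun a b phi.

Lemma test_fun_derivable x : derivable phi x 1.
Proof. by have [/(_ 0%N x)] := tphi. Qed.

Lemma test_fun_continuous : continuous phi.
Proof. by move=> x; exact/differentiable_continuous/derivable1_diffP/test_fun_derivable. Qed.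

Lemma test_fun_continuous_derive1 : continuous (derive1 phi).
Proof.
move=> x; apply/differentiable_continuous/derivable1_diffP.
by have [/(_ 1%N x)] := tphi.
Qed.

Lemma test_fun_support : exists c d : R, [/\ (a < c%:E)%E, (d%:E < b)%E,
  forall x, x < c \/ d < x -> phi x = 0 &
  forall x, x < c \/ d < x -> derive1 phi x = 0].
Proof.
have [_ [c [d [ac db H]]]] := tphi; exists c, d; split => // x xcd.
rewrite derive1E (@near_eq_derive _ _ _ _ (cst (0:R))) ?derive_cst//.
by case: xcd => [xc|dx]; near=> y; apply: H; [left|right];
  near: y; [exact: lt_nbhsl|exact: lt_nbhsr].
Unshelve. all: by end_near. Qed.

Lemma test_fun_integrable_derive1 : mu.-integrable setT (EFin \o derive1 phi).
Proof.
have [c [d [_ _ _ H]]] := test_fun_support.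
have -> : EFin \o derive1 phi = (EFin \o derive1 phi) \_ `[c, d].
  apply/funext => x; rewrite patchE; case: ifPn => // xcd.
  rewrite /= H//; move: xcd; rewrite mem_setE in_itv/= negb_and -!ltNge.
  by move=> /orP[]; [left|right].
apply: (integrable_mkcond _ _).1 => //.
apply: continuous_compact_integrable; first exact: segment_compact.
exact/continuous_subspaceT/test_fun_continuous_derive1.
Qed.

Lemma test_fun_integral_derive1 y : \int[mu]_(z in `]y, +oo[) derive1 phi z = - phi y.
Proof.
have [c [d [_ _ H0 H1]]] := test_fun_support.
(* A point beyond both [y] and the support, so that the fundamental theorem on [y, e] leaves only
   the boundary term at [y]. *)
pose e := Num.max d y + 1.
have ye : y < e by rewrite (le_lt_trans (y := Num.max d y)) ?ltrDl// le_max lexx orbT.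
have de : d < e by rewrite (le_lt_trans (y := Num.max d y)) ?ltrDl// le_max lexx.
have i1 : mu.-integrable setT (EFin \o derive1 phi) by exact: test_fun_integrable_derive1.
rewrite Rintegral_itv_obnd_cbnd; last exact: integrableS i1.
have -> : \int[mu]_(z in `[y, +oo[) derive1 phi z = \int[mu]_(z in `[y, e]) derive1 phi z.
  rewrite [LHS]Rintegral_mkcond [RHS]Rintegral_mkcond; apply: eq_Rintegral => z _.
  rewrite !patchE !mem_setE !in_itv/= andbT.
  case: (leP y z) => //= yz; case: (leP z e) => // ez.
  by rewrite H1//; right; exact: lt_trans ez.
rewrite /Rintegral (@continuous_FTC2 _ _ phi)//.
- by rewrite (H0 e) ?sub0e//; right.
- exact/continuous_subspaceT/test_fun_continuous_derive1.
- split => [z _||].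
  + exact: test_fun_derivable.
  + exact/cvg_at_right_filter/test_fun_continuous.
  + exact/cvg_at_left_filter/test_fun_continuous.
Qed.

End test_functions.

Lemma open_oitv a b : open (oitv a b).
Proof.
rewrite openE => x ox; near \oo => n.
have /andP[lx xh] : lo a n < x < hi b n by near: n; exact: near_lo_hi.
have /andP[ax xb] := ox.
have ab : (a < b)%E by exact: lt_trans ax xb.
near=> y; apply: (itvcc_oitv (lt_lo n ab) (gt_hi n ab)).
rewrite /= in_itv/=; apply/andP; split; apply: ltW; near: y;
  [exact: lt_nbhsr|exact: lt_nbhsl].
Unshelve. all: by end_near. Qed.

Section primitive.
Variable f : R -> R.
Hypothesis f0 : forall x, 0 <= f x.
Hypothesis intf : mu.-integrable setT (EFin \o f).

Lemma primitive_fin x : (\int[mu]_(z in `]-oo, x[) (f z)%:E)%E = (primitive f x)%:E.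
Proof. by rewrite /primitive /Rintegral fineK// integrable_fin_num//; exact: integrableS intf. Qed.

Lemma primitive_ge0 x : 0 <= primitive f x.
Proof. by apply: Rintegral_ge0. Qed.

Lemma primitive_le x : primitive f x <= \int[mu]_z f z.
Proof.
rewrite -lee_fin -primitive_fin /Rintegral fineK; last exact: integrable_fin_num.
apply: ge0_subset_integral => //; last by move=> z _; rewrite lee_fin.
exact: measurable_int intf.
Qed.

Lemma primitive_itv x y : x < y ->
  (\int[mu]_(z in `[x, y[) (f z)%:E)%E = (primitive f y - primitive f x)%:E.
Proof.
move=> xy.
have Efin : (\int[mu]_(z in `[x, y[) (f z)%:E)%E \is a fin_num.
  by apply: integrable_fin_num => //; exact: integrableS intf.
rewrite EFinB -!primitive_fin.
rewrite (_ : `]-oo, y[%classic = `]-oo, x[ `|` `[x, y[); last first.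
  by rewrite -itv_bndbnd_setU// bnd_simp ltW.
rewrite ge0_integral_setU//.
- rewrite addeAC subee ?add0e//.
  by apply: integrable_fin_num => //; exact: integrableS intf.
- by apply: measurable_funTS; exact: measurable_int intf.
- by move=> z _; rewrite lee_fin.
- apply/disj_set2P; rewrite -subset0 => z [/=]; rewrite !in_itv/= => zx /andP[xz _].
  by move: (le_lt_trans xz zx); rewrite ltxx.
Qed.

Lemma primitive_nd : {homo primitive f : x y / x <= y}.
Proof.
move=> x y; rewrite le_eqVlt => /predU1P[->//|xy].
rewrite -subr_ge0 -lee_fin -primitive_itv//.
by apply: integral_ge0 => z _; rewrite lee_fin.
Qed.

(** Fubini for f(y) phi'(z) on the half-plane y < z: integrating in z first gives - f(y) phi(y),
    integrating in y first gives the primitive times phi'. The support of phi then restricts both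
    integrals to ]a, b[. *)
Lemma primitive_weak_deriv a b : weak_deriv a b (primitive f) f.
Proof.
have mO := @measurable_oitv R a b; have oO := @open_oitv a b.
have mP D : measurable D -> measurable_fun D (primitive f).
  by move=> mD; apply: nondecreasing_measurable => //; exact: primitive_nd.
split.
- split => //; first exact: mP.
  move=> K KO cK; have mK := compact_measurable cK.
  apply: (@le_lt_trans _ _ (\int[mu]_(x in K) (\int[mu]_z f z)%:E)%E).
    apply: ge0_le_integral => //.
    - by apply/measurable_EFinP; apply: measurableT_comp => //; exact: mP.
    - move=> x _; rewrite lee_fin ger0_norm ?primitive_ge0//; exact: primitive_le.
  rewrite integral_cst//= lte_mul_pinfty//.
    by rewrite lee_fin; apply: Rintegral_ge0.
  exact: compact_finite_measure.
- apply: open_integrable_locally => //; exact: integrableS intf.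
move=> phi tphi.
have [c [d [ac db H0 H1]]] := test_fun_support tphi.
have mf : measurable_fun setT f by apply/measurable_EFinP; exact: measurable_int intf.
pose ind (y z : R) : R := (y < z)%R%:R.
have indE y z : ind y z = \1_(`]y, +oo[) z by rewrite indicE mem_setE in_itv/= andbT.
pose G (z : R * R) := (f z.1 * (derive1 phi z.2 * ind z.1 z.2))%:E.
have mphi : measurable_fun setT (derive1 phi).
  by apply: continuous_measurable_fun; exact: test_fun_continuous_derive1 tphi.
have mG : measurable_fun setT G.
  apply/measurable_EFinP; apply: measurable_funM; first exact: measurableT_comp.
  apply: measurable_funM; first exact: measurableT_comp.
  by apply: measurable_fun_bool_nat; exact: measurable_fun_ltr.
have iphi := test_fun_integrable_derive1 tphi.
have nphi0 : (0 <= \int[mu]_y `|(derive1 phi y)%:E|)%E by apply: integral_ge0.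
have iphif : (\int[mu]_y `|(derive1 phi y)%:E|)%E \is a fin_num.
  by apply: integrable_fin_num => //; exact: integrable_abse.
have iG : (mu \x mu)%E.-integrable setT G.
  apply/integrable12ltyP => //.
  apply: (@le_lt_trans _ _ (\int[mu]_x ((f x)%:E * \int[mu]_y `|(derive1 phi y)%:E|))%E).
    apply: ge0_le_integral => //.
    - by move=> x _; apply: integral_ge0.
    - have := @measurable_fun_fubini_tonelli_F _ _ _ _ _ mu (abse \o G).
      by apply => // [|z]; [exact: measurableT_comp mG|exact: abse_ge0].
    - by apply: emeasurable_funM; [exact/measurable_EFinP|exact: measurable_cst].
    move=> x _; rewrite -ge0_integralZl//; last 2 first.
      by do 2 apply: measurableT_comp => //.
      by rewrite lee_fin.
    apply: ge0_le_integral => //.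
    - by apply: measurableT_comp => //; exact: (measurableT_comp mG (pair1_measurable x)).
    - by apply: measurable_funeM; do 2 apply: measurableT_comp => //.
    - move=> y _; rewrite /= lee_fin !normrM ger0_norm// ler_wpM2l//.
      by rewrite ler_piMr// /ind; case: (_ < _)%R; rewrite ?normr1 ?normr0.
  rewrite ge0_integralZr//.
  - rewrite lte_mul_pinfty//.
    + by apply: integral_ge0 => x _; rewrite lee_fin.
    + by apply: integrable_fin_num.
    + by rewrite ltey_eq iphif.
  - exact/measurable_EFinP.
  - by move=> x _; rewrite lee_fin.
have := Fubini iG; have := integrable_fubini_F iG; rewrite /fubini_F /G/=.
have -> : (fun x : R => \int[mu]_y (f x * (derive1 phi y * ind x y))%:E)%E =
    fun y => (- (f y * phi y))%:E.
  apply/funext => y.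
  have i1 : mu.-integrable setT (EFin \o (derive1 phi \_ `]y, +oo[)).
    rewrite -restrict_EFin; apply: (integrable_mkcond _ _).1 => //.
    exact: integrableS iphi.
  rewrite -mulrN -(test_fun_integral_derive1 tphi) Rintegral_mkcond EFinM.
  rewrite /Rintegral fineK; last exact: integrable_fin_num.
  rewrite -integralZl//; apply: eq_integral => z _.
  rewrite EFinM; congr (_ * _%:E)%E; rewrite indE indicE patchE.
  by case: ifPn; rewrite ?mulr1 ?mulr0.
have -> : (fun y : R => \int[mu]_x (f x * (derive1 phi y * ind x y))%:E)%E =
    fun z => (primitive f z * derive1 phi z)%:E.
  apply/funext => z.
  have i1 : mu.-integrable setT (EFin \o (f \_ `]-oo, z[)).
    rewrite -restrict_EFin; apply: (integrable_mkcond _ _).1 => //.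
    exact: integrableS intf.
  rewrite /primitive Rintegral_mkcond mulrC EFinM.
  rewrite /Rintegral fineK; last exact: integrable_fin_num.
  rewrite -integralZl//; apply: eq_integral => y _.
  rewrite -EFinM; congr (_%:E); rewrite /ind patchE mem_setE in_itv/=.
  by case: ifPn => yz; rewrite ?mulr1 ?mulr0// mulrC.
move=> iN H.
have out z : ~ oitv a b z -> z < c \/ d < z.
  move=> oz; apply/orP; rewrite !ltNge -negb_and; apply/negP => czd.
  by apply: oz; apply: (itvcc_oitv ac db); rewrite /= in_itv.
have E1 : \int[mu]_(x in oitv a b) (primitive f x * derive1 phi x) =
    \int[mu]_x (primitive f x * derive1 phi x).
  rewrite Rintegral_mkcond; apply: eq_Rintegral => z _; rewrite patchE.
  case: ifPn => //; rewrite notin_setE => oz; rewrite H1 ?mulr0//; exact: out.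
have E2 : \int[mu]_(x in oitv a b) (f x * phi x) =
    \int[mu]_x (f x * phi x).
  rewrite Rintegral_mkcond; apply: eq_Rintegral => z _; rewrite patchE.
  case: ifPn => //; rewrite notin_setE => oz; rewrite H0 ?mulr0//; exact: out.
have -> : \int[mu]_(x in oitv a b) (primitive f x * derive1 phi x) =
    \int[mu]_x (- (f x * phi x)) by rewrite E1 /Rintegral -H.
rewrite E2; suff -> : \int[mu]_x (f x * phi x) = - \int[mu]_x (- (f x * phi x)).
  by rewrite opprK.
rewrite -mulN1r -RintegralZl//.
by apply: eq_Rintegral => x _; rewrite mulN1r opprK.
Qed.

End primitive.
End primitive_weak_deriv.

(** * Hoeffding's identity *)

Section plane_measure.
Context {R : realType}.
Local Notation mu := (@lebesgue_measure R).

(* Keyed alias: the canonical sigma-finite structure of [mu \x mu] is shadowed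
   by the one for products of subprobabilities. *)
Definition plane_measure := (mu \x mu)%E.

HB.instance Definition _ := Measure.on plane_measure.

Lemma plane_measure_sigma_finite : sigma_finite setT plane_measure.
Proof.
exists (fun n => `[- n%:R, n%:R]%classic `*` `[- n%:R, n%:R]%classic).
  apply/seteqP; split => // -[x y] _.
  near \oo => n; exists n => //; split => /=; rewrite in_itv/= -ler_norml;
  near: n; exact: nbhs_infty_ger.
move=> n; have mI : measurable (`[- n%:R, n%:R]%classic : set R) by exact: measurable_itv.
split; first exact: measurableX.
rewrite /plane_measure product_measure1E//= lebesgue_measure_itv/=.
by case: ifPn => _; rewrite -?EFinB -?EFinM ?mule0 ?ltry.
Unshelve. all: by end_near. Qed.

HB.instance Definition _ := Measure_isSigmaFinite.Build _ _ _ plane_measure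
  plane_measure_sigma_finite.

(** Exchanges the pair (x, y) with the pair (s, t) at one stroke in Hoeffding's identity. *)
Lemma fubini_tonelli_plane (F : (R * R) * (R * R) -> \bar R) :
  measurable_fun setT F -> (forall z, 0 <= F z)%E ->
  (\int[mu \x mu]_z \int[mu \x mu]_w F (z, w) =
   \int[mu \x mu]_w \int[mu \x mu]_z F (z, w))%E.
Proof.
move=> mF F0.
exact: (@fubini_tonelli _ _ _ _ _ plane_measure plane_measure F mF F0).
Qed.

Lemma measurable_plane_integral1 (F : (R * R) * (R * R) -> \bar R) :
  measurable_fun setT F -> (forall z, 0 <= F z)%E ->
  measurable_fun setT (fun z => \int[mu \x mu]_w F (z, w))%E.
Proof.
move=> mF F0.
exact: (@measurable_fun_fubini_tonelli_F _ _ _ _ _ plane_measure F mF F0).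
Qed.

Lemma measurable_plane_integral2 (F : (R * R) * (R * R) -> \bar R) :
  measurable_fun setT F -> (forall z, 0 <= F z)%E ->
  measurable_fun setT (fun w => \int[mu \x mu]_z F (z, w))%E.
Proof.
move=> mF F0.
exact: (@measurable_fun_fubini_tonelli_G _ _ _ _ _ plane_measure F mF F0).
Qed.
End plane_measure.

Section hoeffding.
Context {R : realType}.
Implicit Types (f g h : R -> R) (x y s t : R).
Local Notation mu := (@lebesgue_measure R).

Lemma measurable_prodM (g1 g2 : R -> R) : measurable_fun setT g1 -> measurable_fun setT g2 ->
  measurable_fun setT (fun z : R * R => (g1 z.1 * g2 z.2)%:E).
Proof.
by move=> m1 m2; apply/measurable_EFinP; apply: measurable_funM; exact: measurableT_comp.
Qed.

Lemma integral_prodM (g1 g2 : R -> R) : measurable_fun setT g1 -> measurable_fun setT g2 ->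
  (forall x, 0 <= g1 x) -> (forall x, 0 <= g2 x) ->
  (\int[mu \x mu]_z (g1 z.1 * g2 z.2)%:E =
   \int[mu]_x (g1 x)%:E * \int[mu]_x (g2 x)%:E)%E.
Proof.
move=> m1 m2 p1 p2; rewrite fubini_tonelli1/=; last 2 first.
- exact: measurable_prodM.
- by move=> z; rewrite lee_fin mulr_ge0.
rewrite /fubini_F/= -ge0_integralZr//; first last.
- by apply: integral_ge0 => x _; rewrite lee_fin.
- by move=> x _; rewrite lee_fin.
- exact/measurable_EFinP.
apply: eq_integral => x _; rewrite -ge0_integralZl//.
- exact/measurable_EFinP.
- by move=> y _; rewrite lee_fin.
- by rewrite lee_fin.
Qed.

Variable p : R -> R.
Hypothesis p0 : forall x, 0 <= p x.
Hypothesis mp : measurable_fun setT p.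
Hypothesis intp : (\int[mu]_x (p x)%:E = 1)%E.

Definition cumul x := \int[mu]_(y in `]-oo, x]) p y.

Lemma integrable_density : mu.-integrable setT (EFin \o p).
Proof.
apply/integrableP; split; first exact/measurable_EFinP.
under eq_integral do rewrite /= ger0_norm//.
by rewrite intp ltry.
Qed.

Lemma cumulE x : (\int[mu]_(y in `]-oo, x]) (p y)%:E)%E = (cumul x)%:E.
Proof.
rewrite /cumul /Rintegral fineK// integrable_fin_num//.
exact: integrableS integrable_density.
Qed.

Lemma cumulCE x : (\int[mu]_(y in `]x, +oo[) (p y)%:E)%E = (1 - cumul x)%:E.
Proof.
have H : (\int[mu]_(y in `]x, +oo[) (p y)%:E)%E \is a fin_num.
  by apply: integrable_fin_num => //; exact: integrableS integrable_density.
rewrite EFinB -intp -cumulE.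
rewrite (_ : [set: R] = `]-oo, x] `|` `]x, +oo[); last first.
  by rewrite -itv_bndbnd_setU// -?set_itvE// bnd_simp.
rewrite ge0_integral_setU//=.
- by rewrite addeAC subee ?add0e// cumulE.
- by apply: measurable_funTS; exact/measurable_EFinP.
- by move=> z _; rewrite lee_fin.
- apply/disj_set2P; rewrite -subset0 => z [/=]; rewrite !in_itv/= andbT => zx xz.
  by move: (le_lt_trans zx xz); rewrite ltxx.
Qed.

Lemma cumul_ge0 x : 0 <= cumul x.
Proof. by apply: Rintegral_ge0. Qed.

Lemma cumul_le1 x : cumul x <= 1.
Proof.
rewrite -subr_ge0 -lee_fin -cumulCE; apply: integral_ge0 => z _.
by rewrite lee_fin.
Qed.

Lemma cumul_nd : {homo cumul : x y / x <= y}.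
Proof.
move=> x y xy; rewrite -lee_fin -!cumulE; apply: ge0_subset_integral => //.
- by apply: measurable_funTS; exact/measurable_EFinP.
- by move=> z _; rewrite lee_fin.
- by move=> z /=; rewrite !in_itv/= => /le_trans; apply.
Qed.

Definition cker s t := cumul (Num.min s t) * (1 - cumul (Num.max s t)).

Lemma cker_ge0 s t : 0 <= cker s t.
Proof. by rewrite mulr_ge0 ?cumul_ge0// subr_ge0 cumul_le1. Qed.

Lemma ckerC s t : cker s t = cker t s.
Proof. by rewrite /cker minC maxC. Qed.

Lemma measurable_cker : measurable_fun setT (fun z : R * R => cker z.1 z.2).
Proof.
have mc : measurable_fun setT cumul by apply: nondecreasing_measurable => //; exact: cumul_nd.
have mmin : measurable_fun setT (fun z : R * R => Num.min z.1 z.2).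
  by apply: measurable_minr.
have mmax : measurable_fun setT (fun z : R * R => Num.max z.1 z.2).
  by apply: measurable_maxr.
apply: measurable_funM; first exact: measurableT_comp mc mmin.
by apply: measurable_funB => //; exact: measurableT_comp mc mmax.
Qed.

(** The squared integral over [x, y[ is a double integral in (s, t). After Tonelli, fixed s and t
    require x <= min(s, t) and max(s, t) < y, and the p-masses of these two conditions multiply to
    the kernel. *)
Lemma hoeffding f : measurable_fun setT f -> (forall x, 0 <= f x) ->
  (\int[mu]_x \int[mu]_y ((p x * p y)%:E *
     (\int[mu]_(z in `[x, y[) (f z)%:E * \int[mu]_(z in `[x, y[) (f z)%:E)) =
   \int[mu]_s \int[mu]_t (cker s t * f s * f t)%:E)%E.
Proof.
move=> mf f0.
(* The convention x <= s < y agrees exactly with the closed half-line in [cumul]: no atom or null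
   set has to be discussed. *)
pose I (x y s : R) : R := (x <= s)%R%:R * (s < y)%R%:R.
have I0 x y s : 0 <= I x y s by rewrite /I mulr_ge0.
pose F (z : (R * R) * (R * R)) :=
  ((p z.1.1 * p z.1.2) * ((f z.2.1 * I z.1.1 z.1.2 z.2.1) * (f z.2.2 * I z.1.1 z.1.2 z.2.2)))%:E.
have mF : measurable_fun setT F.
  apply/measurable_EFinP.
  have m11 : measurable_fun setT (fun z : (R * R) * (R * R) => z.1.1) by exact: measurableT_comp.
  have m12 : measurable_fun setT (fun z : (R * R) * (R * R) => z.1.2) by exact: measurableT_comp.
  have m21 : measurable_fun setT (fun z : (R * R) * (R * R) => z.2.1) by exact: measurableT_comp.
  have m22 : measurable_fun setT (fun z : (R * R) * (R * R) => z.2.2) by exact: measurableT_comp.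
  have mI (g1 g2 g3 : (R * R) * (R * R) -> R) :
      measurable_fun setT g1 -> measurable_fun setT g2 -> measurable_fun setT g3 ->
      measurable_fun setT (fun z : (R * R) * (R * R) => I (g1 z) (g2 z) (g3 z)).
    move=> h1 h2 h3; apply: measurable_funM; apply: measurable_fun_bool_nat.
      exact: measurable_fun_ler.
    exact: measurable_fun_ltr.
  apply: measurable_funM.
    by apply: measurable_funM; exact: measurableT_comp.
  apply: measurable_funM; apply: measurable_funM.
  - exact: measurableT_comp.
  - exact: mI.
  - exact: measurableT_comp.
  - exact: mI.
have F0 z : (0 <= F z)%E by rewrite lee_fin !mulr_ge0.
transitivity (\int[mu \x mu]_z (\int[mu \x mu]_w F (z, w)))%E.
  rewrite fubini_tonelli1; last 2 first.
  - exact: measurable_plane_integral1.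
  - by move=> z; apply: integral_ge0 => w _; exact: F0.
  apply: eq_integral => x _; apply: eq_integral => y _.
  rewrite /F/=; under [RHS]eq_integral do rewrite EFinM.
  have mI : measurable_fun setT (I x y).
    apply: measurable_funM; apply: measurable_fun_bool_nat.
      exact: measurable_fun_ler.
    exact: measurable_fun_ltr.
  have mfI : measurable_fun setT (fun s => f s * I x y s) by exact: measurable_funM.
  rewrite ge0_integralZl//; last 3 first.
  - exact: (measurable_prodM mfI mfI).
  - by move=> w _; rewrite lee_fin !mulr_ge0.
  - by rewrite lee_fin mulr_ge0.
  rewrite (integral_prodM mfI mfI); [|by move=> z; rewrite mulr_ge0..].
  have -> : (\int[mu]_(z in `[x, y[) (f z)%:E = \int[mu]_z (f z * I x y z)%:E)%E => [|//].
  rewrite integral_mkcond; apply: eq_integral => z _; rewrite patchE mem_setE in_itv/= /I.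
  by case: (x <= z)%R; case: (z < y)%R; rewrite /= ?mulr0 ?mul0r ?mulr1 ?mulr0.
rewrite fubini_tonelli_plane// fubini_tonelli1; last 2 first.
- exact: measurable_plane_integral2.
- by move=> z; apply: integral_ge0 => w _; exact: F0.
apply: eq_integral => s _; apply: eq_integral => t _.
rewrite /F/=.
have E x y : ((p x * p y) * ((f s * I x y s) * (f t * I x y t)))%:E =
  ((f s * f t)%:E * ((p x * (x <= Num.min s t)%R%:R) * (p y * (Num.max s t < y)%R%:R))%:E)%E.
  rewrite -EFinM le_min gt_max /I; congr EFin.
  by case: (x <= s)%R; case: (x <= t)%R; case: (s < y)%R; case: (t < y)%R; rewrite /=; ring.
under eq_integral do rewrite E.
have m1 : measurable_fun setT (fun x => p x * (x <= Num.min s t)%R%:R).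
  by apply: measurable_funM => //; apply: measurable_fun_bool_nat; exact: measurable_fun_ler.
have m2 : measurable_fun setT (fun y => p y * (Num.max s t < y)%R%:R).
  by apply: measurable_funM => //; apply: measurable_fun_bool_nat; exact: measurable_fun_ltr.
rewrite ge0_integralZl//; last 3 first.
- exact: (measurable_prodM m1 m2).
- by move=> w _; rewrite lee_fin !mulr_ge0.
- by rewrite lee_fin mulr_ge0.
rewrite (integral_prodM m1 m2); [|by move=> z; rewrite mulr_ge0..].
rewrite (_ : \int[mu]_x _ = (cumul (Num.min s t))%:E)%E; last first.
  rewrite -cumulE [RHS]integral_mkcond; apply: eq_integral => z _.
  by rewrite patchE mem_setE in_itv/=; case: (z <= _)%R; rewrite ?mulr1 ?mulr0.
rewrite (_ : \int[mu]_x _ = (1 - cumul (Num.max s t))%:E)%E; last first.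
  rewrite -cumulCE [RHS]integral_mkcond; apply: eq_integral => z _.
  by rewrite patchE mem_setE in_itv/= andbT; case: (_ < z)%R; rewrite ?mulr1 ?mulr0.
by rewrite -!EFinM /cker mulrC mulrA.
Qed.

End hoeffding.

(** * The variance as a double integral over x < y *)

Section variance.
Context {R : realType}.
Implicit Types (f g h : R -> R) (x y s t : R).
Local Notation mu := (@lebesgue_measure R).

Lemma integral_EFin_lin3 (f1 f2 f3 : R -> R) (c1 c2 c3 : R) :
  mu.-integrable setT (EFin \o f1) -> mu.-integrable setT (EFin \o f2) ->
  mu.-integrable setT (EFin \o f3) ->
  (\int[mu]_x (c1 * f1 x + c2 * f2 x + c3 * f3 x)%:E =
   (c1 * \int[mu]_x f1 x + c2 * \int[mu]_x f2 x + c3 * \int[mu]_x f3 x)%:E)%E.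
Proof.
move=> i1 i2 i3.
have iZ c (f : R -> R) : mu.-integrable setT (EFin \o f) ->
    mu.-integrable setT (EFin \o (fun x => c * f x)).
  move=> i; have := @integrableZl _ _ _ mu setT measurableT c _ i.
  by rewrite (_ : (fun x => _) = EFin \o (fun x => c * f x)).
have i12 : mu.-integrable setT (EFin \o (fun x => c1 * f1 x + c2 * f2 x)).
  have := @integrableD _ _ _ mu setT measurableT _ _ (iZ c1 _ i1) (iZ c2 _ i2).
  by rewrite (_ : (_ \+ _)%E = EFin \o (fun x => c1 * f1 x + c2 * f2 x)).
have i123 : mu.-integrable setT (EFin \o (fun x => c1 * f1 x + c2 * f2 x + c3 * f3 x)).
  have := @integrableD _ _ _ mu setT measurableT _ _ i12 (iZ c3 _ i3).
  by rewrite (_ : (_ \+ _)%E = EFin \o (fun x => c1 * f1 x + c2 * f2 x + c3 * f3 x)).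
rewrite -[LHS]fineK; last exact: integrable_fin_num.
rewrite -[fine _]/(\int[mu]_x (c1 * f1 x + c2 * f2 x + c3 * f3 x)).
rewrite (RintegralD measurableT i12 (iZ c3 _ i3)).
by rewrite (RintegralD measurableT (iZ c1 _ i1) (iZ c2 _ i2)) !RintegralZl.
Qed.

Variable p : R -> R.
Hypothesis p0 : forall x, 0 <= p x.
Hypothesis mp : measurable_fun setT p.
Hypothesis intp : (\int[mu]_x (p x)%:E = 1)%E.

(** Symmetrisation: adding the contributions of (x, y) and (y, x) removes the condition x < y, and
    expanding the square then gives twice the variance. *)
Lemma variance_double_integral h : measurable_fun setT h ->
  (\int[mu]_x (p x * h x ^+ 2)%:E < +oo)%E ->
  (\int[mu]_x \int[mu]_y (p x * p y * ((x < y)%R%:R * (h y - h x) ^+ 2))%:E =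
   (\int[mu]_x (p x * h x ^+ 2) - (\int[mu]_x (p x * h x)) ^+ 2)%:E)%E.
Proof.
move=> mh h2.
have ip := integrable_density p0 mp intp.
have ip2 : mu.-integrable setT (EFin \o (fun x => p x * h x ^+ 2)).
  apply/integrableP; split.
    by apply/measurable_EFinP; apply: measurable_funM => //; exact: measurable_funX.
  apply: le_lt_trans h2; apply: ge0_le_integral => //.
  - apply/measurable_EFinP; apply: measurableT_comp => //.
    by apply: measurable_funM => //; exact: measurable_funX.
  - by apply/measurable_EFinP; apply: measurable_funM => //; exact: measurable_funX.
  - by move=> x _; rewrite /= lee_fin ger0_norm// mulr_ge0 ?sqr_ge0.
(* Dominated through |h| <= 1 + h^2. *)
have ip1 : mu.-integrable setT (EFin \o (fun x => p x * h x)).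
  have := @integrableD _ _ _ mu setT measurableT _ _ ip ip2.
  apply: le_integrable => //.
    by apply/measurable_EFinP; exact: measurable_funM.
  move=> x _; rewrite /= lee_fin normrM (ger0_norm (p0 x)).
  rewrite (@ger0_norm _ (p x + _)); last by rewrite addr_ge0// mulr_ge0 ?sqr_ge0.
  rewrite -[X in X + _]mulr1 -mulrDr ler_wpM2l//.
  rewrite -(real_normK (num_real (h x))); set u := `|h x|; nra.
set E1 := \int[mu]_x (p x * h x); set E2 := \int[mu]_x (p x * h x ^+ 2).
have ip' : \int[mu]_x p x = 1 by rewrite /Rintegral intp.
pose D (z : R * R) := (p z.1 * p z.2 * ((z.1 < z.2)%R%:R * (h z.2 - h z.1) ^+ 2))%:E.
have D0 z : (0 <= D z)%E by rewrite lee_fin; apply: mulr_ge0; apply: mulr_ge0 => //; exact: sqr_ge0.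
have mD : measurable_fun setT D.
  apply/measurable_EFinP; apply: measurable_funM.
    by apply: measurable_funM; exact: measurableT_comp.
  apply: measurable_funM.
    by apply: measurable_fun_bool_nat; exact: measurable_fun_ltr.
  by apply: measurable_funX; apply: measurable_funB; exact: measurableT_comp.
have m1 x : measurable_fun setT (fun y => D (x, y)).
  exact: measurableT_comp mD (pair1_measurable x).
have m2 x : measurable_fun setT (fun y => D (y, x)).
  exact: measurableT_comp mD (pair2_measurable x).
have F1 : (\int[mu]_x \int[mu]_y (D (x, y) + D (y, x)) =
    (2 * (E2 - E1 ^+ 2))%:E)%E.
  transitivity (\int[mu]_x (E2 * p x + (- 2 * E1) * (p x * h x) + 1 * (p x * h x ^+ 2))%:E)%E.
    apply: eq_integral => x _.
    transitivity (\int[mu]_y ((p x) * (p y * h y ^+ 2) + (- 2 * p x * h x) * (p y * h y) +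
      (p x * h x ^+ 2) * p y)%:E)%E.
      apply: eq_integral => y _; rewrite /D/= -EFinD; congr EFin.
      by have [xy|yx|->] := ltgtP x y; rewrite /=; ring.
    rewrite integral_EFin_lin3// ip' -/E1 -/E2; congr EFin; ring.
  by rewrite integral_EFin_lin3// ip' -/E1 -/E2; congr EFin; ring.
have F2 : (\int[mu]_x \int[mu]_y (D (x, y) + D (y, x)) =
    2%:E * \int[mu]_x \int[mu]_y D (x, y))%E.
  transitivity (\int[mu]_x (\int[mu]_y D (x, y) + \int[mu]_y D (y, x)))%E.
    apply: eq_integral => x _; rewrite ge0_integralD//; [exact: m1|exact: m2].
  rewrite ge0_integralD//.
  - have -> : (\int[mu]_x \int[mu]_y D (y, x) = \int[mu]_x \int[mu]_y D (x, y))%E.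
      exact/esym/(@fubini_tonelli _ _ _ _ _ mu mu D mD D0).
    by rewrite -[2%R]/(1 + 1) EFinD ge0_muleDl ?mul1e.
  - by move=> x _; exact: integral_ge0.
  - exact: measurable_fun_fubini_tonelli_F.
  - by move=> x _; exact: integral_ge0.
  - exact: measurable_fun_fubini_tonelli_G.
move: F1; rewrite F2 EFinM => F1.
(* The double integral is not yet known to be finite, so the factor 2 is removed by multiplying by
   its inverse. *)
have : ((2^-1)%:E * (2%:E * \int[mu]_x \int[mu]_y D (x, y)) =
    (2^-1)%:E * (2%:E * (E2 - E1 ^+ 2)%:E))%E by rewrite F1.
by rewrite !muleA -EFinM mulVf ?pnatr_eq0// !mul1e.
Qed.

End variance.

(** * Reduction to nonnegative functions on the line *)

(** Monotone convergence in the form suited to truncations, which at each point reach their limit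
    after finitely many indices. *)
Lemma cvg_integral_near_cst d (T : measurableType d) (R : realType)
    (m : {measure set T -> \bar R}) (g_ : (T -> \bar R)^nat) (g : T -> \bar R) :
  (forall n, measurable_fun setT (g_ n)) -> (forall n x, 0 <= g_ n x)%E ->
  (forall x, {homo g_^~ x : n k / (n <= k)%N >-> (n <= k)%E}) ->
  (forall x, \forall n \near \oo, g_ n x = g x) ->
  (\int[m]_x g_ n x)%E @[n --> \oo] --> (\int[m]_x g x)%E.
Proof.
move=> mg g0 ndg gg.
have -> : (\int[m]_x g x = \int[m]_x limn (g_^~ x))%E.
  apply: eq_integral => x _; apply/esym/cvg_lim => //.
  by apply: cvg_near_cst; exact: gg.
by apply: cvg_monotone_convergence => // x _; exact: ndg.
Qed.

Section almost_everywhere.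
Context {R : realType}.
Local Notation mu := (@lebesgue_measure R).
Implicit Types P Q : set R.

Lemma aeS P Q : (\forall x \ae mu, P x) -> (forall x, P x -> Q x) -> \forall x \ae mu, Q x.
Proof. by move=> H PQ; apply: filterS H; [exact: (ae_filter_ringOfSetsType mu)|exact: PQ]. Qed.

Lemma aeS2 P1 P2 Q : (\forall x \ae mu, P1 x) -> (\forall x \ae mu, P2 x) ->
  (forall x, P1 x -> P2 x -> Q x) -> \forall x \ae mu, Q x.
Proof.
by move=> H1 H2 PQ; apply: filterS2 H1 H2; [exact: (ae_filter_ringOfSetsType mu)|exact: PQ].
Qed.

Lemma aeI P Q : (\forall x \ae mu, P x) -> (\forall x \ae mu, Q x) ->
  \forall x \ae mu, P x /\ Q x.
Proof. by move=> H1 H2; apply: (aeS2 H1 H2). Qed.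

End almost_everywhere.

Section setting.
Context {R : realType}.
Implicit Types (f g h u : R -> R) (x y s t : R).
Local Notation mu := (@lebesgue_measure R).
Variables (a b : \bar R).
Local Notation O := (oitv a b).

(* The data are positive only almost everywhere on ]a, b[; [ext0] makes them
   nonnegative everywhere and zero outside ]a, b[. *)
Definition ext0 f x : R := if x \in O then Num.max (f x) 0 else 0.

Lemma ext0_ge0 f x : 0 <= ext0 f x.
Proof. by rewrite /ext0; case: ifP => // _; rewrite le_max lexx orbT. Qed.

Lemma ext0_out f x : ~ O x -> ext0 f x = 0.
Proof. by move=> Ox; rewrite /ext0 memNset. Qed.

Lemma ext0_in f x : O x -> 0 <= f x -> ext0 f x = f x.
Proof. by move=> Ox f0; rewrite /ext0 mem_set//; exact: max_l. Qed.

Lemma measurable_ext0 f : measurable_fun O f -> measurable_fun setT (ext0 f).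
Proof.
move=> mf.
have -> : ext0 f = (f \max cst 0) \_ O by apply/funext => x; rewrite patchE.
apply/(measurable_restrictT _ _).1; first exact: measurable_oitv.
by apply: measurable_maxr => //; exact: measurable_cst.
Qed.

Lemma ext0_integral u g : measurable_fun O u -> measurable_fun O g ->
  (\forall x \ae mu, O x -> 0 <= u x) ->
  (\int[mu]_(x in O) (u x * g x)%:E = \int[mu]_x (ext0 u x * g x)%:E)%E.
Proof.
move=> mu_ mg u0; have mO := @measurable_oitv R a b.
transitivity (\int[mu]_(x in O) (ext0 u x * g x)%:E)%E.
  apply: ae_eq_integral => //.
  - by apply/measurable_EFinP; exact: measurable_funM.
  - apply/measurable_EFinP; apply: measurable_funM => //.
    by apply: measurable_funTS; exact: measurable_ext0.
  - by apply: (aeS u0) => x {}u0 Ox; rewrite ext0_in//; exact: u0.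
rewrite integral_mkcond; apply: eq_integral => x _; rewrite patchE.
by case: ifPn => //; rewrite notin_setE => Ox; rewrite ext0_out// mul0r.
Qed.

Variables (p w : R -> R).
Hypothesis dw : density_weight a b p w.

Local Notation ph := (ext0 p).
Local Notation rho := (ext0 (fun x => p x * w x)).

Lemma measurable_p : measurable_fun O p.
Proof. by have [[ip _ _] _] := dw; apply/measurable_EFinP; exact: measurable_int ip. Qed.

Lemma measurable_pw : measurable_fun O (fun x => p x * w x).
Proof. by have [_ [_ _ []]] := dw. Qed.

Lemma p_gt0 : \forall x \ae mu, O x -> 0 < p x.
Proof. by have [[]] := dw. Qed.

Lemma p_ge0 : \forall x \ae mu, O x -> 0 <= p x.
Proof. by apply: (aeS p_gt0) => x H Ox; exact/ltW/H. Qed.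

Lemma pw_gt0 : \forall x \ae mu, O x -> 0 < p x * w x.
Proof.
have [_ [_ w0 _]] := dw.
by apply: (aeS2 p_gt0 w0) => x H1 H2 Ox; rewrite mulr_gt0 ?H1 ?H2.
Qed.

Lemma pw_ge0 : \forall x \ae mu, O x -> 0 <= p x * w x.
Proof. by apply: (aeS pw_gt0) => x H Ox; exact/ltW/H. Qed.

Lemma measurable_ph : measurable_fun setT ph.
Proof. exact: measurable_ext0 measurable_p. Qed.

Lemma measurable_rho : measurable_fun setT rho.
Proof. exact: measurable_ext0 measurable_pw. Qed.

Lemma integral_ph : (\int[mu]_x (ph x)%:E = 1)%E.
Proof.
have [[ip ip1 _] _] := dw.
transitivity (\int[mu]_(x in O) (p x * 1)%:E)%E.
  rewrite (@ext0_integral p (cst 1) measurable_p (measurable_cst _) p_ge0).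
  by apply: eq_integral => x _; rewrite /= mulr1.
transitivity (\int[mu]_(x in O) (p x)%:E)%E.
  by apply: eq_integral => x _; rewrite mulr1.
rewrite -[LHS]fineK; last first.
  by apply: integrable_fin_num ip; exact: measurable_oitv.
by rewrite -[fine _]/(\int[mu]_(x in O) p x) ip1.
Qed.

(** Otherwise [p] would have mass 0. This supplies a point of ]a, b[ and turns a contradiction at
    almost every point of the interval into a contradiction. *)
Lemma oitv_not_null : ~ (\forall x \ae mu, ~ O x).
Proof.
move=> H; have := integral_ph.
rewrite (@ae_eq_integral _ _ _ mu setT (cst 0%E))//.
- by rewrite integral0 => /esym/eqP; rewrite onee_eq0.
- by apply/measurable_EFinP; exact: measurable_ph.
- by apply: (aeS H) => x Ox _; rewrite ext0_out.
Qed.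

Lemma cdf_ext0 x : Defs.cdf a b p x = cumul ph x.
Proof.
rewrite /Defs.cdf /cumul /Rintegral; congr fine.
have mO := @measurable_oitv R a b.
have mOx : measurable (O `&` `]-oo, x]) by exact: measurableI.
rewrite [RHS]integral_mkcond.
transitivity (\int[mu]_(y in O `&` `]-oo, x]) (ph y)%:E)%E.
  apply: ae_eq_integral => //.
  - by apply/measurable_EFinP; apply: measurable_funS measurable_p => // ? [].
  - by apply/measurable_EFinP; apply: measurable_funTS; exact: measurable_ph.
  - by apply: (aeS p_ge0) => z H [Oz _]; rewrite ext0_in// H.
rewrite [LHS]integral_mkcond; apply: eq_integral => y _; rewrite !patchE in_setI.
have [yO|] := boolP (y \in O); first by [].
by rewrite notin_setE => yO; rewrite /= ext0_out//; case: ifP.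
Qed.

Lemma kernelK_ext0 x y : kernelK a b p x y = cker ph x y.
Proof. by rewrite /kernelK /cker !cdf_ext0. Qed.

Definition admissible (c : R) := forall h h', H1 a b p w h h' ->
  Varp a b p h <= c * Ep a b p (fun x => h' x ^+ 2 * w x).

Lemma L2w_ext0 f : measurable_fun O f ->
  L2w a b (fun x => p x * w x) f <-> (\int[mu]_x (rho x * f x ^+ 2)%:E < +oo)%E.
Proof.
move=> mf; rewrite /L2w (ext0_integral measurable_pw _ pw_ge0); last exact: measurable_funX.
by split => [[]|].
Qed.

Lemma Ep_ext0 f : measurable_fun O f -> Ep a b p f = \int[mu]_x (ph x * f x).
Proof. by move=> mf; rewrite /Ep /Rintegral (ext0_integral measurable_p _ p_ge0). Qed.

(** Finite energy guarantees that the real-valued [Ep] is the true integral and not the default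
    0. *)
Lemma energy_ext0 h' : L2w a b (fun x => p x * w x) h' ->
  (Ep a b p (fun x => h' x ^+ 2 * w x))%:E = (\int[mu]_x (rho x * h' x ^+ 2)%:E)%E.
Proof.
move=> [mh' H].
rewrite -(ext0_integral measurable_pw _ pw_ge0); last exact: measurable_funX.
rewrite /Ep /Rintegral fineK.
  by apply: eq_integral => x _; congr EFin; ring.
have -> : (\int[mu]_(x in O) (p x * (h' x ^+ 2 * w x))%:E =
    \int[mu]_(x in O) (p x * w x * h' x ^+ 2)%:E)%E.
  by apply: eq_integral => x _; congr EFin; ring.
rewrite ge0_fin_numE// (ext0_integral measurable_pw _ pw_ge0); last exact: measurable_funX.
by apply: integral_ge0 => x _; rewrite lee_fin mulr_ge0 ?ext0_ge0 ?sqr_ge0.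
Qed.

Lemma varp_ext0 h : measurable_fun O h -> L2w a b p h ->
  (Varp a b p h)%:E =
  (\int[mu]_x \int[mu]_y (ph x * ph y * ((x < y)%R%:R * (h y - h x) ^+ 2))%:E)%E.
Proof.
move=> mh [_ h2].
have mh2 : measurable_fun O (fun x => h x ^+ 2) by exact: measurable_funX.
pose k := h \_ O.
have mk : measurable_fun setT k.
  by apply/(measurable_restrictT _ _).1 => //; exact: measurable_oitv.
(* The zero extension of [p] hides the difference between [h] and its restriction [k], which is
   measurable on the whole line. *)
have E (u : R) x : ph x * (if x \in O then u else 0) = ph x * u.
  by case: ifPn => //; rewrite notin_setE => Ox; rewrite ext0_out// !mul0r.
transitivity (\int[mu]_x \int[mu]_y (ph x * ph y * ((x < y)%R%:R * (k y - k x) ^+ 2))%:E)%E.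
  rewrite (variance_double_integral _ measurable_ph integral_ph mk).
  - rewrite /Varp !Ep_ext0//; congr ((_ - _ ^+ 2)%:E).
      apply: eq_Rintegral => x _; rewrite /k patchE -[in LHS]E.
      by case: ifP => //; rewrite expr0n.
    by apply: eq_Rintegral => x _; rewrite /k patchE E.
  - exact: ext0_ge0.
  - rewrite (ext0_integral measurable_p mh2 p_ge0) in h2; apply: le_lt_trans h2.
    rewrite le_eqVlt; apply/orP; left; apply/eqP.
    apply: eq_integral => x _; rewrite /k patchE -[in RHS]E.
    by case: ifP => //; rewrite expr0n.
apply: eq_integral => x _; apply: eq_integral => y _; congr EFin.
have [Ox|Ox] := boolP (x \in O); last first.
  by rewrite ext0_out ?mul0r// -notin_setE.
have [Oy|Oy] := boolP (y \in O); last first.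
  by rewrite (@ext0_out p y) ?mulr0 ?mul0r// -notin_setE.
by rewrite /k !patchE Ox Oy.
Qed.

End setting.

(** * The kernel form and the weighted energy *)

Section energy_forms.
Context {R : realType}.
Implicit Types (f g h u : R -> R) (x y s t c : R).
Local Notation mu := (@lebesgue_measure R).

(** Indicators move the moving endpoints into a jointly measurable integrand, and the integral
    becomes a partial integral of Tonelli's theorem. *)
Lemma measurable_integral_itv f : measurable_fun setT f -> (forall x, 0 <= f x) ->
  measurable_fun setT (fun z : R * R => \int[mu]_(t in `[z.1, z.2[) (f t)%:E)%E.
Proof.
move=> mf f0.
pose F (z : (R * R) * R) := (f z.2 * ((z.1.1 <= z.2)%R%:R * (z.2 < z.1.2)%R%:R))%:E.
have F0 z : (0 <= F z)%E by rewrite lee_fin !mulr_ge0.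
have m11 : measurable_fun setT (fun z : (R * R) * R => z.1.1) by exact: measurableT_comp.
have m12 : measurable_fun setT (fun z : (R * R) * R => z.1.2) by exact: measurableT_comp.
have mF : measurable_fun setT F.
  apply/measurable_EFinP; apply: measurable_funM; first exact: measurableT_comp.
  apply: measurable_funM; apply: measurable_fun_bool_nat.
    exact: measurable_fun_ler.
  exact: measurable_fun_ltr.
have -> : (fun z : R * R => \int[mu]_(t in `[z.1, z.2[) (f t)%:E)%E = fubini_F mu F.
  apply/funext => z; rewrite /fubini_F [LHS]integral_mkcond; apply: eq_integral => t _.
  rewrite patchE mem_setE in_itv/= /F/=.
  by case: (z.1 <= t)%R; case: (t < z.2)%R; rewrite /= ?mulr0 ?mul0r ?mulr1 ?mulr0.
exact: measurable_fun_fubini_tonelli_F.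
Qed.

Variables (a b : \bar R) (p w : R -> R).
Local Notation O := (oitv a b).
Hypothesis ab : (a < b)%E.
Hypothesis dw : density_weight a b p w.
Local Notation ph := (ext0 a b p).
Local Notation rho := (ext0 a b (fun x => p x * w x)).
Local Notation K := (cker ph).

Let ph0 x : 0 <= ph x := @ext0_ge0 R a b p x.
Let rho0 x : 0 <= rho x := @ext0_ge0 R a b _ x.
Let mph : measurable_fun setT ph := measurable_ph dw.
Let mrho : measurable_fun setT rho := measurable_rho dw.
Let iph := integral_ph dw.

Definition kform f := (\int[mu]_s \int[mu]_t (K s t * f s * f t)%:E)%E.
Definition wenergy f := (\int[mu]_x (rho x * f x ^+ 2)%:E)%E.

Lemma K_ge0 s t : 0 <= K s t.
Proof. exact: cker_ge0. Qed.

Lemma KM_ge0 s t (u v : R) : 0 <= u -> 0 <= v -> 0 <= K s t * u * v.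
Proof.
by move=> u0 v0; apply: mulr_ge0 => //; apply: mulr_ge0 => //; exact: K_ge0.
Qed.

Lemma measurable_kform f g : measurable_fun setT f -> measurable_fun setT g ->
  measurable_fun setT (fun z : R * R => (K z.1 z.2 * f z.1 * g z.2)%:E).
Proof.
move=> mf mg; apply/measurable_EFinP; apply: measurable_funM; last exact: measurableT_comp.
by apply: measurable_funM; [exact: measurable_cker|exact: measurableT_comp].
Qed.

Lemma energy_ge0 f : (0 <= wenergy f)%E.
Proof. by apply: integral_ge0 => x _; rewrite lee_fin mulr_ge0 ?sqr_ge0. Qed.

Lemma kform_plane f : measurable_fun setT f -> (forall x, 0 <= f x) ->
  kform f = (\int[mu \x mu]_z (K z.1 z.2 * f z.1 * f z.2)%:E)%E.
Proof.
move=> mf f0; rewrite fubini_tonelli1//; first exact: measurable_kform.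
by move=> z; rewrite lee_fin; exact: KM_ge0.
Qed.

(** For almost every pair the increment formula bounds |h y - h x| by the integral of |h'| over [x,
    y[. Squared and weighted by p, the bound is the left side of Hoeffding's identity for |h'|; it
    may be infinite. *)
Lemma var_le_kform h h' : H1 a b p w h h' ->
  ((Varp a b p h)%:E <= kform (ext0 a b (fun x => `|h' x|%R)))%E.
Proof.
move=> [wd L2h [mh' _]]; have [mh _] := L2h.
rewrite (varp_ext0 dw mh L2h).
set f := ext0 a b (fun x => `|h' x|).
have f0 x : 0 <= f x by exact: ext0_ge0.
have mf : measurable_fun setT f by apply: measurable_ext0; exact: measurableT_comp.
rewrite /kform -(hoeffding ph0 mph iph mf f0).
have [G aeG HG] := weak_deriv_increment ab wd.
pose k := h \_ O.
have mk : measurable_fun setT k.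
  by apply/(measurable_restrictT _ _).1 => //; exact: measurable_oitv.
pose D (z : R * R) := (ph z.1 * ph z.2 * ((z.1 < z.2)%R%:R * (k z.2 - k z.1) ^+ 2))%:E.
have D0 z : (0 <= D z)%E by rewrite lee_fin; apply: mulr_ge0; apply: mulr_ge0 => //; exact: sqr_ge0.
have mD : measurable_fun setT D.
  apply/measurable_EFinP; apply: measurable_funM.
    by apply: measurable_funM; exact: measurableT_comp.
  apply: measurable_funM.
    by apply: measurable_fun_bool_nat; exact: measurable_fun_ltr.
  by apply: measurable_funX; apply: measurable_funB; exact: measurableT_comp.
have -> : (\int[mu]_x \int[mu]_y (ph x * ph y * ((x < y)%R%:R * (h y - h x) ^+ 2))%:E =
    \int[mu]_x \int[mu]_y D (x, y))%E.
  apply: eq_integral => x _; apply: eq_integral => y _; congr EFin.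
  have [Ox|Ox] := boolP (x \in O); last first.
    by rewrite /D/= ext0_out ?mul0r// -notin_setE.
  have [Oy|Oy] := boolP (y \in O); last first.
    by rewrite /D/= (@ext0_out _ _ _ p y) ?mulr0 ?mul0r// -notin_setE.
  by rewrite /D/k/= !patchE Ox Oy.
pose E (z : R * R) := ((ph z.1 * ph z.2)%:E *
  (\int[mu]_(t in `[z.1, z.2[) (f t)%:E * \int[mu]_(t in `[z.1, z.2[) (f t)%:E))%E.
have I0 x y : (0 <= \int[mu]_(t in `[x, y[) (f t)%:E)%E.
  by apply: integral_ge0 => t _; rewrite lee_fin.
have E0 z : (0 <= E z)%E by rewrite /E mule_ge0 ?mule_ge0// lee_fin mulr_ge0.
have mE : measurable_fun setT E.
  apply: emeasurable_funM.
    by apply/measurable_EFinP; apply: measurable_funM; exact: measurableT_comp.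
  by apply: emeasurable_funM; exact: measurable_integral_itv.
apply: (@ae_ge0_le_integral _ _ _ mu setT _ _ (fun x => \int[mu]_y E (x, y))%E) => //.
- by move=> x _; exact: integral_ge0.
- exact: measurable_fun_fubini_tonelli_F.
- by move=> x _; exact: integral_ge0.
- exact: measurable_fun_fubini_tonelli_F.
apply: (aeS aeG) => x Gx _.
apply: (@ae_ge0_le_integral _ _ _ mu setT _ _ (fun y => E (x, y))) => //.
- exact: measurableT_comp mD (pair1_measurable x).
- exact: measurableT_comp mE (pair1_measurable x).
apply: (aeS aeG) => y Gy _; rewrite /D/E/=.
have [Ox|Ox] := boolP (x \in O); last first.
  by rewrite ext0_out ?mul0r ?mul0e// -notin_setE.
have [Oy|Oy] := boolP (y \in O); last first.
  by rewrite (@ext0_out _ _ _ p y) ?mulr0 ?mul0r ?mul0e// -notin_setE.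
rewrite EFinM; apply: lee_pmul => //.
- by rewrite lee_fin; exact: mulr_ge0.
- by rewrite lee_fin; apply: mulr_ge0 => //; exact: sqr_ge0.
have [xy|xy] := ltP x y; last by rewrite /= mul0r mule_ge0.
rewrite /= mul1r /k !patchE Ox Oy.
move/set_mem : Ox => Ox; move/set_mem : Oy => Oy.
have /andP[ax _] := Ox; have /andP[_ yb] := Oy.
have xyO : `[x, y[ `<=` O.
  apply: (subset_trans _ (itvcc_oitv ax yb)) => z /=.
  by rewrite !in_itv/= => /andP[-> /ltW].
have [_ lh' _] := wd.
have ih' : mu.-integrable `[x, y[ (EFin \o h').
  apply: integrableS (Lloc1_integrable lh' ax yb) => // z /=.
  by rewrite !in_itv/= => /andP[-> /ltW].
have H : (`|h y - h x|%:E <= \int[mu]_(t in `[x, y[) (f t)%:E)%E.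
  rewrite -(HG x y)// EFin_normr_Rintegral//.
  apply: le_trans (le_abse_integral _ _ _) _ => //; first exact: measurable_int ih'.
  rewrite le_eqVlt; apply/orP; left; apply/eqP; apply: eq_integral => z /set_mem xyz.
  by rewrite /f ext0_in//; exact: xyO.
rewrite -(real_normK (num_real (h y - h x))) expr2 EFinM.
by apply: lee_pmul => //; rewrite lee_fin.
Qed.

Hypothesis h2 : hypH2 a b p w.

(** By (H2), [f] is integrable on the compact interval that carries it; its primitive is then
    bounded, hence in L^2(p), and can be tested. Hoeffding's identity is exact for it since f >=
    0. *)
Lemma kform_le_energy_compact c f n : admissible a b p w c ->
  measurable_fun setT f -> (forall x, 0 <= f x) ->
  (forall x, ~ `[lo a n, hi b n]%classic x -> f x = 0) ->
  (wenergy f < +oo)%E -> (kform f <= c%:E * wenergy f)%E.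
Proof.
move=> adm mf f0 fout ef.
have mO := @measurable_oitv R a b.
have mfO : measurable_fun O f by exact: measurable_funTS.
have L2f : L2w a b (fun x => p x * w x) f by apply/(L2w_ext0 dw).
have intf : mu.-integrable setT (EFin \o f).
  have -> : EFin \o f = (EFin \o f) \_ `[lo a n, hi b n].
    apply/funext => x; rewrite patchE; case: ifPn => //.
    by rewrite notin_setE => xn; rewrite /= fout.
  apply: (integrable_mkcond _ _).1 => //.
  exact: Lloc1_integrable (h2 L2f) (lt_lo n ab) (gt_hi n ab).
pose h := primitive f.
have mh : measurable_fun O h.
  by apply: nondecreasing_measurable => //; exact: primitive_nd.
have L2h : L2w a b p h.
  split => //.
  have mh2 : measurable_fun O (fun x => h x ^+ 2) by exact: measurable_funX.
  rewrite (ext0_integral (measurable_p dw) mh2 (p_ge0 dw)).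
  pose M := (\int[mu]_z f z) ^+ 2.
  apply: (@le_lt_trans _ _ (\int[mu]_x (M%:E * (ph x)%:E))%E).
    apply: ge0_le_integral => //.
    - by move=> x _; rewrite lee_fin mulr_ge0 ?sqr_ge0.
    - apply/measurable_EFinP; apply: measurable_funM => //; apply: measurable_funX.
      by apply: nondecreasing_measurable => //; exact: primitive_nd.
    - by apply: measurable_funeM; exact/measurable_EFinP.
    - move=> x _; rewrite -EFinM lee_fin mulrC ler_wpM2r// lerXn2r ?nnegrE//.
      + exact: primitive_ge0.
      + exact: Rintegral_ge0.
      + exact: primitive_le.
  rewrite ge0_integralZl//.
  - by rewrite iph mule1 ltry.
  - exact/measurable_EFinP.
  - by move=> x _; rewrite lee_fin.
  - by rewrite lee_fin sqr_ge0.
have Hh : H1 a b p w h f by split => //; exact: primitive_weak_deriv.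
have := adm _ _ Hh; rewrite -lee_fin EFinM (energy_ext0 dw L2f) (varp_ext0 dw mh L2h).
apply: le_trans; rewrite /kform -(hoeffding ph0 mph iph mf f0).
rewrite le_eqVlt; apply/orP; left; apply/eqP.
apply: eq_integral => x _; apply: eq_integral => y _; rewrite [RHS]EFinM; congr (_ * _)%E.
have [xy|yx] := ltP x y.
  by rewrite (primitive_itv f0 intf xy) /= mul1r expr2.
by rewrite set_itv_ge /= ?integral_set0 ?mul0r ?mule0// bnd_simp -leNgt.
Qed.

(** Near the ends of ]a, b[ [f] may fail to be integrable and so have no primitive to test. Its
    restrictions to the exhausting intervals increase to it, and both sides pass to the limit. *)
Lemma kform_le_energy c f : admissible a b p w c ->
  measurable_fun setT f -> (forall x, 0 <= f x) -> (forall x, ~ O x -> f x = 0) ->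
  (wenergy f < +oo)%E -> (kform f <= c%:E * wenergy f)%E.
Proof.
move=> adm mf f0 fout ef.
pose J n := `[lo a n, hi b n]%classic.
pose f_ n := f \_ (J n).
have mJ n : measurable (J n) by exact: measurable_itv.
have mf_ n : measurable_fun setT (f_ n).
  by apply/(measurable_restrictT _ _).1 => //; exact: measurable_funTS.
have f_0 n x : 0 <= f_ n x by rewrite /f_ patchE; case: ifP.
have f_le n x : f_ n x <= f x by rewrite /f_ patchE; case: ifP.
have f_nd x : {homo f_^~ x : n k / (n <= k)%N >-> n <= k}.
  move=> n k nk; rewrite /f_ !patchE; case: ifPn => xn; last by case: ifP.
  rewrite ifT//; move: xn; rewrite !mem_setE !in_itv/= => /andP[h1 h2'].
  by rewrite (le_trans (lo_nincr _ nk) h1) (le_trans h2' (hi_ndecr _ nk)).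
have f_cvg x : \forall n \near \oo, f_ n x = f x.
  have [Ox|Ox] := pselect (O x).
    near=> n; rewrite /f_ patchE ifT// mem_setE in_itv/=.
    have /andP[/ltW -> /ltW ->//] : lo a n < x < hi b n by near: n; exact: near_lo_hi.
  by near=> n; rewrite /f_ patchE fout//; case: ifP.
have me g : measurable_fun setT g -> measurable_fun setT (fun x => (rho x * g x ^+ 2)%:E).
  by move=> mg; apply/measurable_EFinP; apply: measurable_funM => //; exact: measurable_funX.
have ce : wenergy (f_ n) @[n --> \oo] --> wenergy f.
  apply: cvg_integral_near_cst.
  - by move=> n; exact: me.
  - by move=> n x; rewrite lee_fin mulr_ge0 ?sqr_ge0.
  - move=> x n k nk; rewrite lee_fin ler_wpM2l// lerXn2r ?nnegrE//; exact: f_nd.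
  - move=> x; near=> n; rewrite (_ : f_ n x = f x)//; near: n; exact: f_cvg.
have ck : kform (f_ n) @[n --> \oo] --> kform f.
  (* Seen as an integral over the plane, the form needs a single monotone convergence. *)
  rewrite (kform_plane mf f0).
  have -> : (fun n => kform (f_ n)) =
      fun n => (\int[mu \x mu]_z (K z.1 z.2 * f_ n z.1 * f_ n z.2)%:E)%E.
    by apply/funext => n; exact: kform_plane.
  apply: cvg_integral_near_cst.
  - by move=> n; exact: measurable_kform.
  - by move=> n z; rewrite lee_fin; exact: KM_ge0.
  - move=> z n k nk; rewrite lee_fin -!(mulrA (K _ _)); apply: ler_wpM2l; first exact: K_ge0.
    by apply: ler_pM => //; exact: f_nd.
  - move=> z; near=> n.
    have -> : f_ n z.1 = f z.1 by near: n; exact: f_cvg.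
    have -> : f_ n z.2 = f z.2 by near: n; exact: f_cvg.
    by [].
have cce : (c%:E * wenergy (f_ n))%E @[n --> \oo] --> (c%:E * wenergy f)%E by exact: cvgeZl.
apply: (lee_cvg_to ck cce).
near=> n.
apply: (@kform_le_energy_compact _ _ n) => //.
  by move=> x xn; rewrite /f_ patchE memNset.
apply: le_lt_trans ef; apply: ge0_le_integral => //.
- by move=> x _; rewrite lee_fin mulr_ge0 ?sqr_ge0.
- exact: me.
- exact: me.
- by move=> x _; rewrite lee_fin ler_wpM2l// lerXn2r ?nnegrE.
Unshelve. all: by end_near. Qed.

End energy_forms.

(** * The kernel operator *)

Section positivity.
Context {R : realType}.
Local Notation mu := (@lebesgue_measure R).

(** Since the inverse of 0 is 0, inversion equals its own restriction by zero to the open set where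
    it is continuous. *)
Lemma measurable_invr : measurable_fun setT (@GRing.inv R).
Proof.
pose D := [set x : R | x != 0].
have oD : open D.
  rewrite (_ : D = ~` [set 0]); first exact/closed_openC/closed_eq.
  by apply/seteqP; split => x /=; [move/eqP|move=> /eqP].
have -> : @GRing.inv R = @GRing.inv R \_ D.
  apply/funext => x; rewrite patchE; case: ifPn => //.
  by rewrite notin_setE /D/= => /negP; rewrite negbK => /eqP ->; rewrite invr0.
apply/(measurable_restrictT _ _).1; first exact: open_measurable.
apply: open_continuous_measurable_fun => // x /set_mem x0.
exact: inv_continuous.
Qed.

(** A zero integral would force f = 0 almost everywhere on ]c, d[, making this interval a null
    set. *)
Lemma integral_gt0_itv (f : R -> R) (c d : R) : c < d -> measurable_fun setT f ->
  (forall x, 0 <= f x) -> (\forall x \ae mu, `]c, d[%classic x -> 0 < f x) ->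
  (0 < \int[mu]_(x in `]c, d[) (f x)%:E)%E.
Proof.
move=> cd mf f0 fpos; rewrite lt0e; apply/andP; split; last first.
  by apply: integral_ge0 => x _; rewrite lee_fin.
apply/eqP => H.
have : (\int[mu]_(x in `]c, d[) `|(f x)%:E| = 0)%E.
  by rewrite -[RHS]H; apply: eq_integral => x _; rewrite gee0_abs// lee_fin.
move=> /ae_eq_integral_abs H2.
have {H2} H2 : \forall x \ae mu, `]c, d[%classic x -> (f x)%:E = 0%E.
  by apply: H2 => //; apply/measurable_EFinP; exact: measurable_funTS.
have [N [mN N0 H3]] : \forall x \ae mu, ~ `]c, d[%classic x.
  by apply: (aeS2 fpos H2) => x h1 h2 xcd; have := h1 xcd; case: (h2 xcd) => ->; rewrite ltxx.
have : (mu `]c, d[ <= mu N)%E.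
  by apply: le_measure; rewrite ?inE// => x xcd; apply: H3 => /=; exact.
by rewrite N0 lebesgue_measure_itv/= lte_fin cd -EFinB lee_fin leNgt subr_gt0 cd.
Qed.

Lemma integral_gt0 (f : R -> R) (c d : R) : c < d -> measurable_fun setT f ->
  (forall x, 0 <= f x) -> (\forall x \ae mu, `]c, d[%classic x -> 0 < f x) ->
  (0 < \int[mu]_x (f x)%:E)%E.
Proof.
move=> cd mf f0 fpos; apply: lt_le_trans (integral_gt0_itv cd mf f0 fpos) _.
apply: ge0_subset_integral => //; first exact/measurable_EFinP.
by move=> x _; rewrite lee_fin.
Qed.

End positivity.

Section kernel_operator.
Context {R : realType}.
Implicit Types (f g h u : R -> R) (x y s t c : R).
Local Notation mu := (@lebesgue_measure R).
Variables (a b : \bar R) (p w : R -> R).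
Local Notation O := (oitv a b).
Hypothesis ab : (a < b)%E.
Hypothesis dw : density_weight a b p w.
Local Notation ph := (ext0 a b p).
Local Notation rho := (ext0 a b (fun x => p x * w x)).
Local Notation K := (cker ph).
Local Notation energy := (wenergy a b p w).
Local Notation kform := (kform a b p).

Let ph0 x : 0 <= ph x := @ext0_ge0 R a b p x.
Let rho0 x : 0 <= rho x := @ext0_ge0 R a b _ x.
Let mph : measurable_fun setT ph := measurable_ph dw.
Let mrho : measurable_fun setT rho := measurable_rho dw.
Let iph := integral_ph dw.

Lemma oitv_itv x : O x -> exists2 n, lo a n < x < hi b n & `]lo a n, hi b n[ `<=` O.
Proof.
move=> Ox; near \oo => n; exists n; first by near: n; exact: near_lo_hi.
apply: (subset_trans _ (itvcc_oitv (lt_lo n ab) (gt_hi n ab))) => z /=.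
by rewrite !in_itv/= => /andP[/ltW -> /ltW].
Unshelve. all: by end_near. Qed.

Lemma ph_gt0 : \forall x \ae mu, O x -> 0 < ph x.
Proof. by apply: (aeS (p_gt0 dw)) => x H Ox; rewrite ext0_in// ?ltW// H. Qed.

Lemma rho_gt0 : \forall x \ae mu, O x -> 0 < rho x.
Proof. by apply: (aeS (pw_gt0 dw)) => x H Ox; rewrite ext0_in// ?ltW// H. Qed.

(** To the left of [x] lies an interval contained in ]a, b[, where [p] is positive almost
    everywhere; [cumul_lt1] uses one to the right. *)
Lemma cumul_gt0 x : O x -> 0 < cumul ph x.
Proof.
move=> Ox; have [n /andP[lx xh] nO] := oitv_itv Ox.
rewrite -lte_fin -cumulE//.
apply: (lt_le_trans (@integral_gt0_itv _ ph _ _ lx mph ph0 _)).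
  apply: (aeS ph_gt0) => z H zx; apply: H; apply: nO; move: zx => /=.
  by rewrite !in_itv/= => /andP[-> /lt_trans]; exact.
apply: ge0_subset_integral => //.
- by apply/measurable_EFinP; exact: measurable_funTS.
- by move=> z _; rewrite lee_fin.
- by move=> z /=; rewrite !in_itv/= => /andP[_ /ltW].
Qed.

Lemma cumul_lt1 x : O x -> cumul ph x < 1.
Proof.
move=> Ox; have [n /andP[lx xh] nO] := oitv_itv Ox.
rewrite -subr_gt0 -lte_fin -cumulCE//.
apply: (lt_le_trans (@integral_gt0_itv _ ph _ _ xh mph ph0 _)).
  apply: (aeS ph_gt0) => z H zx; apply: H; apply: nO; move: zx => /=.
  by rewrite !in_itv/= => /andP[/(lt_trans lx) -> ->].
apply: ge0_subset_integral => //.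
- by apply/measurable_EFinP; exact: measurable_funTS.
- by move=> z _; rewrite lee_fin.
- by move=> z /=; rewrite !in_itv/= andbT => /andP[].
Qed.

Lemma K_gt0 x y : O x -> O y -> 0 < K x y.
Proof.
move=> Ox Oy; apply: mulr_gt0; first by apply: cumul_gt0; rewrite /Num.min; case: ifP.
by rewrite subr_gt0; apply: cumul_lt1; rewrite /Num.max; case: ifP.
Qed.

(** Extended-valued, so that it makes sense before finiteness is known; on positive functions
    [Ltilde] is its [fine] part divided by p w. *)
Definition Kop f s := (\int[mu]_t (K s t * f t)%:E)%E.

Let K0 s t : 0 <= K s t := K_ge0 dw s t.

Lemma measurable_Kpair f : measurable_fun setT f ->
  measurable_fun setT (fun z : R * R => (K z.1 z.2 * f z.2)%:E).
Proof.
move=> mf; apply/measurable_EFinP.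
by apply: measurable_funM; [exact: measurable_cker|exact: measurableT_comp].
Qed.

Lemma measurable_K s : measurable_fun setT (K s).
Proof. exact: measurableT_comp (measurable_cker ph0 mph iph) (pair1_measurable s). Qed.

Lemma measurable_KM s f : measurable_fun setT f ->
  measurable_fun setT (fun t => (K s t * f t)%:E).
Proof.
by move=> mf; apply/measurable_EFinP; apply: measurable_funM => //; exact: measurable_K.
Qed.

Lemma Kop_ge0 f s : (forall x, 0 <= f x) -> (0 <= Kop f s)%E.
Proof. by move=> f0; apply: integral_ge0 => t _; rewrite lee_fin; exact: mulr_ge0. Qed.

Lemma measurable_Kop f : measurable_fun setT f -> (forall x, 0 <= f x) ->
  measurable_fun setT (Kop f).
Proof.
move=> mf f0.
apply: (@measurable_fun_fubini_tonelli_F _ _ _ _ _ mu _ (measurable_Kpair mf)) => z.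
by rewrite lee_fin; exact: mulr_ge0.
Qed.

Lemma kform2E g f : measurable_fun setT g -> measurable_fun setT f ->
  (forall x, 0 <= g x) -> (forall x, 0 <= f x) ->
  (\int[mu]_s \int[mu]_t (K s t * g s * f t)%:E = \int[mu]_s ((g s)%:E * Kop f s))%E.
Proof.
move=> mg mf g0 f0; apply: eq_integral => s _.
rewrite -ge0_integralZl//.
- by apply: eq_integral => t _; rewrite -EFinM; congr EFin; ring.
- exact: measurable_KM.
- by move=> t _; rewrite lee_fin; exact: mulr_ge0.
- by rewrite lee_fin.
Qed.

Lemma le_Kop f g s : measurable_fun setT f -> measurable_fun setT g ->
  (forall x, 0 <= f x) -> (forall x, 0 <= g x) ->
  (\forall x \ae mu, f x <= g x) -> (Kop f s <= Kop g s)%E.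
Proof.
move=> mf mg f0 g0 fg; apply: ae_ge0_le_integral => //.
- by move=> t _; rewrite lee_fin; exact: mulr_ge0.
- exact: measurable_KM.
- by move=> t _; rewrite lee_fin; exact: mulr_ge0.
- exact: measurable_KM.
- by apply: (aeS fg) => t H _; rewrite lee_fin; exact: ler_wpM2l.
Qed.

Lemma KopZ f (r : R) s : measurable_fun setT f -> (forall x, 0 <= f x) -> 0 <= r ->
  Kop (fun x => r * f x) s = (r%:E * Kop f s)%E.
Proof.
move=> mf f0 r0; rewrite /Kop -ge0_integralZl//.
- by apply: eq_integral => t _; rewrite -EFinM; congr EFin; ring.
- exact: measurable_KM.
- by move=> t _; rewrite lee_fin; exact: mulr_ge0.
Qed.

Lemma Kop_gt0 f x : measurable_fun setT f -> (forall x, 0 <= f x) ->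
  (\forall x \ae mu, O x -> 0 < f x) -> O x -> (0 < Kop f x)%E.
Proof.
move=> mf f0 fpos Ox; have [n /andP[lx xh] nO] := oitv_itv Ox.
apply: (@integral_gt0 _ _ (lo a n) (hi b n)).
- exact: lt_trans xh.
- by apply/measurable_EFinP; exact: measurable_KM.
- by move=> t; exact: mulr_ge0.
- by apply: (aeS fpos) => t H /nO Ot; rewrite mulr_gt0 ?H// K_gt0.
Qed.

Lemma energy_gt0 f : measurable_fun setT f ->
  (\forall x \ae mu, O x -> 0 < f x) -> (0 < energy f)%E.
Proof.
move=> mf fpos.
have [x Ox] : exists x, O x.
  by apply: contra_notP (@oitv_not_null R a b p w dw) => /forallNP H; exact: aeW.
have [n /andP[lx xh] nO] := oitv_itv Ox.
apply: (@integral_gt0 _ _ (lo a n) (hi b n)).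
- exact: lt_trans xh.
- by apply: measurable_funM => //; exact: measurable_funX.
- by move=> t; rewrite mulr_ge0 ?sqr_ge0.
- by apply: (aeS2 fpos rho_gt0) => t H1 H2 /nO Ot; rewrite mulr_gt0 ?H2// exprn_gt0// H1.
Qed.

Lemma admissible_le c d : c <= d -> admissible a b p w c -> admissible a b p w d.
Proof.
move=> cd adm h h' Hh; apply: le_trans (adm _ _ Hh) _; rewrite ler_wpM2r//.
have [_ _ L2] := Hh.
by rewrite -lee_fin (energy_ext0 dw L2); exact: energy_ge0.
Qed.

Hypothesis h2 : hypH2 a b p w.
Variable c0 : R.
Hypothesis adm0 : admissible a b p w c0.

Section finite_energy.
Variable f : R -> R.
Hypothesis mf : measurable_fun setT f.
Hypothesis f0 : forall x, 0 <= f x.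
Hypothesis fout : forall x, ~ O x -> f x = 0.
Hypothesis ef : (energy f < +oo)%E.

Let mE g : measurable_fun setT g -> measurable_fun setT (fun x => (rho x * g x ^+ 2)%:E).
Proof.
by move=> mg; apply/measurable_EFinP; apply: measurable_funM => //; exact: measurable_funX.
Qed.

Let E0 g x : (0 <= (rho x * g x ^+ 2)%:E)%E.
Proof. by rewrite lee_fin mulr_ge0 ?sqr_ge0. Qed.

(** The integral of f times [Kop f] is the kernel form, finite by the energy inequality; hence the
    product is finite almost everywhere, and so is [Kop f] where f > 0. *)
Lemma Kop_fin : (\forall x \ae mu, O x -> 0 < f x) ->
  \forall x \ae mu, O x -> Kop f x \is a fin_num.
Proof.
move=> fpos.
have H : (\int[mu]_s ((f s)%:E * Kop f s) < +oo)%E.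
  rewrite -kform2E//; apply: le_lt_trans (kform_le_energy ab dw h2 adm0 mf f0 fout ef) _.
  have ee : energy f \is a fin_num by rewrite ge0_fin_numE// energy_ge0.
  by rewrite -(fineK ee) -EFinM ltry.
have : mu.-integrable setT (fun s => (f s)%:E * Kop f s)%E.
  apply/integrableP; split.
    by apply: emeasurable_funM; [exact/measurable_EFinP|exact: measurable_Kop].
  apply: le_lt_trans H; rewrite le_eqVlt; apply/orP; left; apply/eqP.
  apply: eq_integral => x _; rewrite gee0_abs// mule_ge0 ?lee_fin ?Kop_ge0//.
move=> /integrable_ae H1.
have {H1} H1 : \forall x \ae mu, ((f x)%:E * Kop f x)%E \is a fin_num.
  by apply: (aeS (H1 _)) => // x; apply.
apply: (aeS2 fpos H1) => x fx Kx Ox; move: Kx; have := @Kop_ge0 f x f0.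
by case: (Kop f x) => // _; rewrite gt0_muley ?lte_fin// fx.
Qed.

(* Testing the energy inequality on f + t phi, where phi truncates g and
   t = 1 / (4 c), bounds the energy of phi by 16 c^2 energy f. *)
Lemma energy_Kop_lty g : measurable_fun setT g -> (forall x, 0 <= g x) ->
  (forall x, ~ O x -> g x = 0) -> (forall x, ((rho x * g x)%:E <= Kop f x)%E) ->
  (energy g < +oo)%E.
Proof.
move=> mg g0 gout gK.
(* Raised to at least 1 so that t = 1 / (4 c) is defined and positive. *)
pose c := Num.max c0 1.
have c1 : 1 <= c by rewrite le_max lexx orbT.
have cpos : 0 < c by exact: lt_le_trans c1.
have admc : admissible a b p w c by apply: admissible_le adm0; rewrite le_max lexx.
pose J n := `[lo a n, hi b n]%classic.
have mJ n : measurable (J n) by exact: measurable_itv.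
(* Cut both in height and in support: the energy is at most n^2 times the integral of p w over
   [J n], finite by local integrability. *)
pose phi n := (fun x => Num.min (g x) n%:R) \_ (J n).
have mphi n : measurable_fun setT (phi n).
  apply/(measurable_restrictT _ _).1 => //; apply: measurable_funTS.
  by apply: measurable_minr => //; exact: measurable_cst.
have phi0 n x : 0 <= phi n x by rewrite /phi patchE; case: ifP => // _; rewrite le_min g0/=.
have phig n x : phi n x <= g x by rewrite /phi patchE; case: ifP => // _; rewrite ge_min lexx.
have phiout n x : ~ O x -> phi n x = 0.
  by move=> Ox; apply/eqP; rewrite eq_le phi0 andbT -(gout _ Ox).
have A_fin : energy f \is a fin_num by rewrite ge0_fin_numE// energy_ge0.
have B_lty n : (energy (phi n) < +oo)%E.
  have ipw : mu.-integrable (J n) (EFin \o (fun x => p x * w x)).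
    have [_ [_ _ lpw]] := dw.
    exact: Lloc1_integrable lpw (lt_lo n ab) (gt_hi n ab).
  have mpw : measurable_fun (J n) (fun x => `|(p x * w x)%:E|%E).
    by apply: measurableT_comp => //; exact: measurable_int ipw.
  apply: (@le_lt_trans _ _ (\int[mu]_(x in J n) ((n%:R ^+ 2)%:E * `|(p x * w x)%:E|))%E).
    rewrite [leRHS]integral_mkcond; apply: ge0_le_integral => //.
    - exact: mE.
    - by apply/(measurable_restrictT _ _).1; [exact: mJ|exact: (measurable_funeM _ mpw)].
    - move=> x _; rewrite /phi !patchE; case: ifPn => xJ; last by rewrite expr0n mulr0.
      rewrite /= lee_fin mulrC; apply: ler_pM => //; first exact: sqr_ge0.
        have m0 : 0 <= Num.min (g x) n%:R by rewrite le_min g0/=.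
        have mn : Num.min (g x) n%:R <= n%:R by rewrite ge_min lexx orbT.
        by rewrite lerXn2r ?nnegrE.
      rewrite /ext0; case: ifP => // _; rewrite ge_max normr_ge0 andbT; exact: ler_norm.
  rewrite ge0_integralZl; [|exact: mJ|exact: mpw|by []|by rewrite lee_fin sqr_ge0].
  by apply: lte_mul_pinfty; [rewrite lee_fin sqr_ge0| |have /integrableP[] := ipw].
have B_fin n : energy (phi n) \is a fin_num by rewrite ge0_fin_numE// energy_ge0.
set A := fine (energy f); pose B n := fine (energy (phi n)).
have B0 n : 0 <= B n by rewrite fine_ge0// energy_ge0.
(* Since 4 c t = 1, the estimate t B <= 2 c A + 2 c t^2 B reads t B <= 2 c A + t B / 2. Absorbing
   the last term, which uses that B is finite, gives t B <= 4 c A, and B = 4 c (t B). *)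
have BA n : B n <= 16 * c ^+ 2 * A.
  pose t := (4 * c)^-1.
  have t0 : 0 < t by rewrite invr_gt0 mulr_gt0.
  pose F x := f x + t * phi n x.
  have mF : measurable_fun setT F by apply: measurable_funD => //; exact: measurable_funM.
  have F0 x : 0 <= F x by rewrite addr_ge0// mulr_ge0// ltW.
  have Fout x : ~ O x -> F x = 0 by move=> Ox; rewrite /F fout// phiout// mulr0 addr0.
  have EF : (energy F <= (2 * A + 2 * t ^+ 2 * B n)%:E)%E.
    have tt0 : (0 <= (2 * t ^+ 2)%:E)%E by rewrite lee_fin mulr_ge0 ?sqr_ge0.
    apply: (@le_trans _ _ (\int[mu]_x (2%:E * (rho x * f x ^+ 2)%:E +
        (2 * t ^+ 2)%:E * (rho x * phi n x ^+ 2)%:E))%E).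
      apply: ge0_le_integral => //.
      - exact: mE.
      - by apply: emeasurable_funD; apply: measurable_funeM; exact: mE.
      - move=> x _; rewrite -!EFinM -EFinD lee_fin /F.
        have : 0 <= rho x * (f x - t * phi n x) ^+ 2 by rewrite mulr_ge0 ?sqr_ge0.
        nra.
    rewrite ge0_integralD//.
    - rewrite !ge0_integralZl//; [|exact: mE|exact: mE].
      rewrite -/(energy f) -/(energy (phi n)) -(fineK A_fin) -(fineK (B_fin n)).
      by rewrite -!EFinM -EFinD.
    - by move=> x _; rewrite mule_ge0// E0.
    - by apply: measurable_funeM; exact: mE.
    - by move=> x _; rewrite mule_ge0// E0.
    - by apply: measurable_funeM; exact: mE.
  have EF_lty : (energy F < +oo)%E by apply: le_lt_trans EF _; rewrite ltry.
  (* Of the form of f + t phi only one cross term K(x, y) t phi(x) f(y) is kept. Its integral in y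
     is t phi times [Kop f], at least t rho phi g, hence at least t rho phi^2. *)
  have H1 : (t%:E * energy (phi n) <= kform F)%E.
    pose tphi x := t * phi n x.
    have mtphi : measurable_fun setT tphi by exact: measurable_funM.
    have tphi0 x : 0 <= tphi x by rewrite mulr_ge0// ltW.
    apply: (@le_trans _ _ (\int[mu]_s ((tphi s)%:E * Kop f s))%E).
      rewrite -ge0_integralZl//; [|exact: mE|by rewrite lee_fin ltW].
      apply: ge0_le_integral => //.
      - by move=> x _; rewrite mule_ge0 ?E0// lee_fin ltW.
      - by apply: measurable_funeM; exact: mE.
      - by apply: emeasurable_funM; [exact/measurable_EFinP|exact: measurable_Kop].
      - move=> x _; rewrite /tphi (EFinM t) -muleA; apply: lee_wpmul2l.
          by rewrite lee_fin ltW.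
        apply: (@le_trans _ _ ((phi n x)%:E * (rho x * g x)%:E)%E); last first.
          by apply: lee_wpmul2l => //; rewrite lee_fin.
        rewrite -EFinM lee_fin expr2 mulrCA; apply: ler_wpM2l => //.
        by rewrite ler_wpM2l.
    rewrite -kform2E//; apply: ge0_le_integral => //.
    - by move=> x _; apply: integral_ge0 => y _; rewrite lee_fin; exact: (KM_ge0 dw).
    - apply: (@measurable_fun_fubini_tonelli_F _ _ _ _ _ mu _ (measurable_kform dw mtphi mf)) => z.
      by rewrite lee_fin; exact: (KM_ge0 dw).
    - apply: (@measurable_fun_fubini_tonelli_F _ _ _ _ _ mu _ (measurable_kform dw mF mF)) => z.
      by rewrite lee_fin; exact: (KM_ge0 dw).
    move=> x _; apply: ge0_le_integral => //.
    - by move=> y _; rewrite lee_fin; exact: (KM_ge0 dw).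
    - exact: measurableT_comp (measurable_kform dw mtphi mf) (pair1_measurable x).
    - exact: measurableT_comp (measurable_kform dw mF mF) (pair1_measurable x).
    - move=> y _; rewrite lee_fin -!(mulrA (K _ _)); apply: ler_wpM2l => //.
      apply: ler_pM => //; first by rewrite /F lerDr.
      by rewrite /F lerDl tphi0.
  have H2 := kform_le_energy ab dw h2 admc mF F0 Fout EF_lty.
  have : t * B n <= c * (2 * A + 2 * t ^+ 2 * B n).
    rewrite -lee_fin EFinM fineK//; apply: le_trans H1 _; apply: le_trans H2 _.
    by rewrite EFinM; apply: lee_wpmul2l => //; rewrite lee_fin ltW.
  have ct : c * t = 4^-1 by rewrite /t; field; rewrite gt_eqF.
  have -> : c * (2 * A + 2 * t ^+ 2 * B n) = 2 * c * A + 2 * (c * t) * (t * B n) by ring.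
  rewrite ct => tB.
  have {}tB : t * B n <= 4 * c * A by lra.
  have -> : B n = 4 * c * (t * B n) by rewrite /t; field; rewrite gt_eqF.
  have -> : 16 * c ^+ 2 * A = 4 * c * (4 * c * A) by ring.
  by rewrite ler_wpM2l// mulr_ge0// ltW.
have Hcvg : energy (phi n) @[n --> \oo] --> energy g.
  apply: cvg_integral_near_cst.
  - by move=> n; exact: mE.
  - by move=> n x; exact: E0.
  - move=> x n k nk; rewrite lee_fin ler_wpM2l// lerXn2r ?nnegrE//.
    rewrite {1}/phi patchE; case: ifPn => // xn.
    rewrite /phi patchE ifT.
      by rewrite le_min ge_min lexx/= ge_min ler_nat nk orbT.
    move: xn; rewrite !mem_setE !in_itv/= => /andP[h1 h2'].
    by rewrite (le_trans (lo_nincr _ nk) h1) (le_trans h2' (hi_ndecr _ nk)).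
  - move=> x; have [Ox|Ox] := pselect (O x); last by near=> n; rewrite phiout// gout.
    near=> n; rewrite /phi patchE ifT.
      by rewrite min_l//; near: n; exact: nbhs_infty_ger.
    rewrite mem_setE in_itv/=.
    have /andP[/ltW -> /ltW ->//] : lo a n < x < hi b n by near: n; exact: near_lo_hi.
apply: (@le_lt_trans _ _ (16 * c ^+ 2 * A)%:E); last by rewrite ltry.
apply: (lee_cvg_to Hcvg (cvg_cst (16 * c ^+ 2 * A)%:E)).
by near=> n; rewrite -[leLHS]fineK// lee_fin; exact: BA.
Unshelve. all: by end_near. Qed.

End finite_energy.
End kernel_operator.

(** * Ratios of iterates *)

Section iterates.
Context {R : realType}.
Implicit Types (f g h u : R -> R) (x y s t c r : R).
Local Notation mu := (@lebesgue_measure R).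
Variables (a b : \bar R) (p w : R -> R).
Local Notation O := (oitv a b).
Hypothesis ab : (a < b)%E.
Hypothesis dw : density_weight a b p w.
Hypothesis h2 : hypH2 a b p w.
Local Notation ph := (ext0 a b p).
Local Notation rho := (ext0 a b (fun x => p x * w x)).
Local Notation K := (cker ph).
Local Notation energy := (wenergy a b p w).
Local Notation kform := (kform a b p).
Local Notation Kop := (Kop a b p).
Local Notation L := (Ltilde a b p w).
Local Notation hat := (ext0 a b).

(** The restricted measure ignores the complement of ]a, b[, which can be added to any null set. *)
Lemma ae_mu_on (P : set R) :
  (\forall x \ae mu_on a b, P x) <-> (\forall x \ae mu, O x -> P x).
Proof.
have mO := @measurable_oitv R a b.
split => [[N [mN N0 PN]]|[N [mN N0 PN]]].
  exists (N `&` O); split; [exact: measurableI|exact: N0|].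
  by move=> x /not_implyP[Ox nPx]; split => //; exact: PN.
exists (N `|` ~` O); split; first by apply: measurableU => //; exact: measurableC.
  rewrite /mu_on /mrestr/= setIUl setICl setU0.
  apply/eqP; rewrite eq_le measure_ge0 andbT -N0.
  by apply: le_measure; rewrite ?inE//; exact: measurableI.
move=> x nPx; have [Ox|Ox] := pselect (O x); last by right.
by left; apply: PN => /(_ Ox).
Qed.

Lemma ae_ext0 g : (\forall x \ae mu, O x -> 0 < g x) -> \forall x \ae mu, O x -> hat g x = g x.
Proof. by move=> g0; apply: (aeS g0) => x H Ox; rewrite ext0_in// ltW// H. Qed.

Lemma ae_ext0_gt0 g : (\forall x \ae mu, O x -> 0 < g x) ->
  \forall x \ae mu, O x -> 0 < hat g x.
Proof. by move=> g0; apply: (aeS2 g0 (ae_ext0 g0)) => x H E Ox; rewrite E//; exact: H. Qed.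

(** Valid at every [x]: where the kernel integral is infinite, both sides carry the same default
    0. *)
Lemma Ltilde_ext0 g x : measurable_fun O g -> (\forall x \ae mu, O x -> 0 < g x) ->
  L g x = (p x * w x)^-1 * fine (Kop (hat g) x).
Proof.
move=> mg g0; rewrite /Ltilde /Rintegral; congr (_ * fine _).
have g0' : \forall x \ae mu, O x -> 0 <= g x by apply: (aeS g0) => z H Oz; exact/ltW/H.
have mK : measurable_fun O (K x) by apply: measurable_funTS; exact: measurable_K dw x.
transitivity (\int[mu]_(y in O) (g y * K x y)%:E)%E.
  by apply: eq_integral => y _; rewrite (kernelK_ext0 dw) mulrC.
rewrite (ext0_integral mg mK g0').
by apply: eq_integral => y _; rewrite mulrC.
Qed.

(** The invariant of the iteration. *)
Definition posL2 g := [/\ measurable_fun O g, (\forall x \ae mu, O x -> 0 < g x) &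
  (energy (hat g) < +oo)%E].

Lemma posL2_init g : L2w a b (fun x => p x * w x) g ->
  (\forall x \ae mu, O x -> 0 < g x) -> posL2 g.
Proof.
move=> [mg Eg] g0; split => //; apply: le_lt_trans Eg.
have mO := @measurable_oitv R a b.
have mhg : measurable_fun O (hat g) by apply: measurable_funTS; exact: measurable_ext0.
rewrite /wenergy -(ext0_integral (measurable_pw dw) _ (pw_ge0 dw)); last exact: measurable_funX.
rewrite le_eqVlt; apply/orP; left; apply/eqP; apply: ae_eq_integral => //.
- apply/measurable_EFinP; apply: measurable_funM; first exact: (measurable_pw dw).
  exact: measurable_funX.
- apply/measurable_EFinP; apply: measurable_funM; first exact: (measurable_pw dw).
  exact: measurable_funX.
- by apply: (aeS (ae_ext0 g0)) => x H Ox; rewrite H.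
Qed.

Variable c0 : R.
Hypothesis adm0 : admissible a b p w c0.

Section posL2_function.
Variable g : R -> R.
Hypothesis gg : posL2 g.

Let mg : measurable_fun O g. Proof. by have [] := gg. Qed.
Let g0 : \forall x \ae mu, O x -> 0 < g x. Proof. by have [] := gg. Qed.
Let eg : (energy (hat g) < +oo)%E. Proof. by have [] := gg. Qed.
Let mhg : measurable_fun setT (hat g). Proof. exact: measurable_ext0. Qed.
Let hg0 x : 0 <= hat g x. Proof. exact: ext0_ge0. Qed.
Let hgout x : ~ O x -> hat g x = 0. Proof. exact: ext0_out. Qed.
Let hgpos : \forall x \ae mu, O x -> 0 < hat g x. Proof. exact: ae_ext0_gt0. Qed.

Lemma Kop_posL2_fin : \forall x \ae mu, O x -> Kop (hat g) x \is a fin_num.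
Proof. exact: (Kop_fin ab dw h2 adm0 mhg hg0 hgout eg). Qed.

(** [Kop] is finite almost everywhere here, so [fine] loses nothing and p w cancels. *)
Lemma Kop_Ltilde : \forall x \ae mu, O x -> Kop (hat g) x = (p x * w x * L g x)%:E.
Proof.
apply: (aeS2 Kop_posL2_fin (pw_gt0 dw)) => x Kx pwx Ox.
rewrite Ltilde_ext0// mulrA mulfV ?gt_eqF ?pwx// mul1r fineK//; exact: Kx.
Qed.

Lemma Ltilde_gt0 : \forall x \ae mu, O x -> 0 < L g x.
Proof.
apply: (aeS2 Kop_Ltilde (pw_gt0 dw)) => x Kx pwx Ox.
have := Kop_gt0 ab dw mhg hg0 hgpos Ox.
by rewrite Kx// lte_fin pmulr_rgt0// pwx.
Qed.

Lemma measurable_Ltilde : measurable_fun O (L g).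
Proof.
have mO := @measurable_oitv R a b.
have -> : L g = fun x => (p x * w x)^-1 * fine (Kop (hat g) x).
  by apply/funext => x; exact: Ltilde_ext0.
apply: measurable_funM.
  exact: measurableT_comp measurable_invr (measurable_pw dw).
apply: measurable_funTS; apply: measurableT_comp; first exact: fine_measurable.
exact: (measurable_Kop dw).
Qed.

Lemma posL2_Ltilde : posL2 (L g).
Proof.
split; [exact: measurable_Ltilde|exact: Ltilde_gt0|].
apply: (energy_Kop_lty ab dw h2 adm0 mhg hg0 hgout eg).
- by apply: measurable_ext0; exact: measurable_Ltilde.
- by move=> x; exact: ext0_ge0.
- by move=> x; exact: ext0_out.
(* An inequality is enough and holds everywhere: where the kernel integral is infinite, [fine] gives
   0 on the left; where p w <= 0 or outside ]a, b[, the extended weight is 0. *)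
- move=> x; have K0 := @Kop_ge0 R a b p w dw (hat g) x hg0.
  have [Ox|Ox] := pselect (O x); last by rewrite ext0_out// mul0r.
  have [pwx|pwx] := ltP 0 (p x * w x); last first.
    by rewrite {1}/ext0 mem_set// max_r// mul0r.
  rewrite (@ext0_in _ _ _ (fun x => p x * w x) x Ox (ltW pwx)) ext0_in//; last first.
    by rewrite Ltilde_ext0// mulr_ge0 ?invr_ge0 ?fine_ge0// ltW.
  rewrite Ltilde_ext0// mulrA mulfV ?gt_eqF// mul1r.
  by case: (Kop (hat g) x) K0 => [z _|_|]//=; rewrite ?lexx ?leey.
Qed.

Lemma kform_posL2 : kform (hat g) = (\int[mu]_s ((hat g s)%:E * Kop (hat g) s))%E.
Proof. exact: (kform2E dw). Qed.

Lemma ratio_ge_admissible r c : admissible a b p w c ->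
  (\forall x \ae mu, O x -> r <= L g x / g x) -> r <= c.
Proof.
move=> adm Hr.
(* A negative [r] is replaced by 0, which still bounds the positive ratio and keeps all integrands
   nonnegative. *)
have H0 : \forall x \ae mu, O x -> Num.max r 0 <= L g x / g x.
  apply: (aeS2 Hr (aeI g0 Ltilde_gt0)) => x H [H1 H2] Ox.
  by rewrite ge_max H//=; apply: divr_ge0; apply: ltW; [exact: H2|exact: H1].
apply: (@le_trans _ _ (Num.max r 0)); first by rewrite le_max lexx.
move: H0; set r' := Num.max r 0 => H0.
have r0 : 0 <= r' by rewrite le_max lexx orbT.
have ef : energy (hat g) \is a fin_num by rewrite ge0_fin_numE// energy_ge0.
(* Finite and positive, the energy can be cancelled from the final inequality. *)
have epos : 0 < fine (energy (hat g)).
  by rewrite fine_gt0// eg andbT; exact: (energy_gt0 ab dw).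
have mE : measurable_fun setT (fun x => (rho x * hat g x ^+ 2)%:E).
  apply/measurable_EFinP; apply: measurable_funM; first exact: (measurable_rho dw).
  exact: measurable_funX.
have E0 x : (0 <= (rho x * hat g x ^+ 2)%:E)%E by rewrite lee_fin mulr_ge0 ?ext0_ge0 ?sqr_ge0.
have := kform_le_energy ab dw h2 adm mhg hg0 hgout eg.
rewrite kform_posL2 => H.
have : (r'%:E * energy (hat g) <= c%:E * energy (hat g))%E.
  apply: le_trans H; rewrite -ge0_integralZl//.
  apply: ae_ge0_le_integral => //.
  - by move=> x _; rewrite mule_ge0// E0.
  - exact: measurable_funeM.
  - by move=> x _; rewrite mule_ge0 ?lee_fin//; exact: (Kop_ge0 dw).
  - by apply: emeasurable_funM; [exact/measurable_EFinP|exact: (measurable_Kop dw)].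
  apply: (aeS2 (aeI H0 Kop_Ltilde) (aeI g0 (aeI (pw_gt0 dw) (ae_ext0 g0)))).
  move=> x [H1 H2] [H3 [H4 H5]] _.
  have [Ox|Ox] := pselect (O x); last by rewrite !ext0_out// mul0r mul0e mule0.
  rewrite H2// H5// (@ext0_in _ _ _ (fun x => p x * w x) x Ox (ltW (H4 Ox))) -!EFinM lee_fin.
  have {}H1 := H1 Ox; have {}H3 := H3 Ox; have {}H4 := H4 Ox.
  rewrite ler_pdivlMr// in H1.
  have -> : r' * (p x * w x * g x ^+ 2) = (g x * (p x * w x)) * (r' * g x) by ring.
  by rewrite [leRHS]mulrA ler_wpM2l// ltW// mulr_gt0.
rewrite -(fineK ef) -!EFinM lee_fin ler_pM2r//.
Qed.

(* Schur test: K(s,t) f(s) f(t) <= K(s,t) (f(s)^2 g(t)/g(s) + f(t)^2 g(s)/g(t)) / 2. *)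
Lemma ratio_le_admissible r :
  (\forall x \ae mu, O x -> L g x / g x <= r) -> admissible a b p w r.
Proof.
move=> Hr h h' Hh.
have [_ _ L2h'] := Hh; have [mh' _] := L2h'.
rewrite -lee_fin EFinM (energy_ext0 dw L2h').
apply: (le_trans (var_le_kform ab dw Hh)).
set f := hat (fun x => `|h' x|).
have f0 x : 0 <= f x by exact: ext0_ge0.
have mf : measurable_fun setT f by apply: measurable_ext0; exact: measurableT_comp.
have fout x : ~ O x -> f x = 0 by exact: ext0_out.
have -> : (\int[mu]_x (rho x * h' x ^+ 2)%:E = energy f)%E.
  apply: eq_integral => x _; congr EFin.
  have [Ox|Ox] := pselect (O x); last by rewrite ext0_out// !mul0r.
  by rewrite /f (@ext0_in _ _ _ (fun x => `|h' x|))// real_normK// num_real.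
(* A negative upper bound on a positive ratio is impossible, as the interval is not null. *)
have [r0|r0] := leP 0 r; last first.
  exfalso; apply: (oitv_not_null dw).
  apply: (aeS2 Hr (aeI g0 Ltilde_gt0)) => x H [H1 H2] Ox.
  have : 0 < L g x / g x by rewrite divr_gt0 ?H1 ?H2.
  by rewrite ltNge (le_trans (H Ox))// ltW.
(* Paired with [Kop] of g, the function f^2 / g gives the integral of p w f^2 (L g / g), at most r
   times the energy of f; this is one half of the symmetric Schur bound. *)
pose u x := f x ^+ 2 * (hat g x)^-1.
have u0 x : 0 <= u x by rewrite mulr_ge0 ?invr_ge0 ?sqr_ge0.
have mu_ : measurable_fun setT u.
  apply: measurable_funM; first exact: measurable_funX.
  exact: measurableT_comp measurable_invr mhg.
pose G (z : R * R) := (K z.1 z.2 * u z.1 * hat g z.2)%:E.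
have G0 z : (0 <= G z)%E by rewrite lee_fin; exact: (KM_ge0 dw).
have mG : measurable_fun setT G by exact: (measurable_kform dw).
have mG1 x : measurable_fun setT (fun y => G (x, y)).
  exact: measurableT_comp mG (pair1_measurable x).
have mG2 x : measurable_fun setT (fun y => G (y, x)).
  exact: measurableT_comp mG (pair2_measurable x).
pose A := (\int[mu]_s \int[mu]_t G (s, t))%E.
have AE : (A <= r%:E * energy f)%E.
  rewrite /A (kform2E dw mu_ mhg u0 hg0) -ge0_integralZl//; last 2 first.
  - apply/measurable_EFinP; apply: measurable_funM; first exact: (measurable_rho dw).
    exact: measurable_funX.
  - by move=> x _; rewrite lee_fin mulr_ge0 ?ext0_ge0 ?sqr_ge0.
  apply: ae_ge0_le_integral => //.
  - by move=> x _; rewrite mule_ge0 ?lee_fin//; exact: (Kop_ge0 dw).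
  - by apply: emeasurable_funM; [exact/measurable_EFinP|exact: (measurable_Kop dw)].
  - by move=> x _; rewrite mule_ge0// lee_fin mulr_ge0 ?ext0_ge0 ?sqr_ge0.
  - apply: measurable_funeM; apply/measurable_EFinP; apply: measurable_funM.
      exact: (measurable_rho dw).
    exact: measurable_funX.
  apply: (aeS2 (aeI Hr Kop_Ltilde) (aeI g0 (aeI (pw_gt0 dw) (ae_ext0 g0)))).
  move=> x [H1 H2] [H3 [H4 H5]] _.
  have [Ox|Ox] := pselect (O x); last first.
    by rewrite /u !fout// expr0n/= !mul0r mulr0 mul0e mule0.
  rewrite H2// /u H5// (@ext0_in _ _ _ (fun x => p x * w x) x Ox (ltW (H4 Ox))) -!EFinM lee_fin.
  have {}H1 := H1 Ox; have {}H3 := H3 Ox; have {}H4 := H4 Ox.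
  have -> : f x ^+ 2 / g x * (p x * w x * L g x) = (p x * w x * f x ^+ 2) * (L g x / g x).
    by ring.
  by rewrite [leRHS]mulrC; apply: ler_wpM2l => //; apply: mulr_ge0; [exact: ltW|exact: sqr_ge0].
have : (2%:E * kform f <= A + A)%E.
  have -> : (A + A = \int[mu]_s \int[mu]_t (G (s, t) + G (t, s)))%E.
    have {2}-> : (A = \int[mu]_x \int[mu]_y G (y, x))%E.
      exact: (@fubini_tonelli _ _ _ _ _ mu mu G mG G0).
    rewrite -ge0_integralD//.
    - by apply: eq_integral => x _; rewrite ge0_integralD//; [exact: mG1|exact: mG2].
    - by move=> x _; exact: integral_ge0.
    - exact: measurable_fun_fubini_tonelli_F.
    - by move=> x _; exact: integral_ge0.
    - exact: measurable_fun_fubini_tonelli_G.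
  pose D (z : R * R) := (2%:E * (K z.1 z.2 * f z.1 * f z.2)%:E)%E.
  have D0 z : (0 <= D z)%E by rewrite mule_ge0// lee_fin; exact: (KM_ge0 dw).
  have mD : measurable_fun setT D.
    by apply: measurable_funeM; exact: (measurable_kform dw).
  pose S (z : R * R) := (G z + G (z.2, z.1))%E.
  have S0 z : (0 <= S z)%E by rewrite adde_ge0.
  have mS : measurable_fun setT S.
    have msw : measurable_fun setT (fun z : R * R => (z.2, z.1)).
      by apply: measurable_fun_pair.
    by apply: emeasurable_funD => //; exact: (measurableT_comp mG msw).
  have -> : (2%:E * kform f = \int[mu]_s \int[mu]_t D (s, t))%E.
    rewrite -ge0_integralZl//.
    - apply: eq_integral => s _; rewrite ge0_integralZl//.
      + exact: measurableT_comp (measurable_kform dw mf mf) (pair1_measurable s).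
      + by move=> t _; rewrite lee_fin; exact: (KM_ge0 dw).
    - apply: (@measurable_fun_fubini_tonelli_F _ _ _ _ _ mu _ (measurable_kform dw mf mf)) => z.
      by rewrite lee_fin; exact: (KM_ge0 dw).
    - by move=> s _; apply: integral_ge0 => t _; rewrite lee_fin; exact: (KM_ge0 dw).
  apply: (@ae_ge0_le_integral _ _ _ mu setT _ _ (fun s => \int[mu]_t S (s, t))%E) => //.
  - by move=> s _; exact: integral_ge0.
  - exact: measurable_fun_fubini_tonelli_F.
  - by move=> s _; exact: integral_ge0.
  - exact: measurable_fun_fubini_tonelli_F.
  apply: (aeS hgpos) => s gs _.
  apply: (@ae_ge0_le_integral _ _ _ mu setT _ _ (fun t => S (s, t))) => //.
  - exact: measurableT_comp mD (pair1_measurable s).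
  - exact: measurableT_comp mS (pair1_measurable s).
  apply: (aeS hgpos) => t gt _.
  have [Os|Os] := pselect (O s); last by rewrite /D/= (fout s Os) mulr0 mul0r mule0 S0.
  have [Ot|Ot] := pselect (O t); last by rewrite /D/= (fout t Ot) mulr0 mule0 S0.
  have {}gs := gs Os; have {}gt := gt Ot.
  rewrite /D/S/G/u/= (ckerC ph t s) -EFinM -EFinD lee_fin.
  (* The arithmetic-geometric inequality as a completed square. *)
  have -> : K s t * (f s ^+ 2 / hat g s) * hat g t + K s t * (f t ^+ 2 / hat g t) * hat g s =
      2 * (K s t * f s * f t) +
      K s t * ((f s * hat g t - f t * hat g s) ^+ 2 / (hat g s * hat g t)).
    by field; rewrite !gt_eqF.
  rewrite lerDl; apply: mulr_ge0; first exact: (K_ge0 dw).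
  by apply: divr_ge0; [exact: sqr_ge0|rewrite mulr_ge0].
move=> H; rewrite -(@lee_pmul2l _ 2%:E)//; apply: (le_trans H).
by rewrite -[2%R]/(1 + 1) EFinD ge0_muleDl// mul1e leeD.
Qed.

End posL2_function.

Section ratio.
Variables (g : R -> R) (gg : posL2 g).

Let mLg : measurable_fun O (L g). Proof. exact: measurable_Ltilde gg. Qed.
Let ggL : posL2 (L g). Proof. exact: posL2_Ltilde. Qed.
Let g0 : \forall x \ae mu, O x -> 0 < g x. Proof. by have [] := gg. Qed.
Let Lg0 : \forall x \ae mu, O x -> 0 < L g x. Proof. by have [] := ggL. Qed.
Let LLg0 : \forall x \ae mu, O x -> 0 < L (L g) x. Proof. by have [] := posL2_Ltilde ggL. Qed.
Let mhg : measurable_fun setT (hat g). Proof. by apply: measurable_ext0; have [] := gg. Qed.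
Let mhLg : measurable_fun setT (hat (L g)). Proof. exact: measurable_ext0. Qed.

Lemma ratio_ge_Ltilde r : (\forall x \ae mu, O x -> r <= L g x / g x) ->
  \forall x \ae mu, O x -> r <= L (L g) x / L g x.
Proof.
(* A negative lower bound is trivial for a positive ratio; a nonnegative one passes through the
   kernel integral. *)
move=> Hr; have [r0|r0] := leP 0 r; last first.
  apply: (aeS2 Lg0 LLg0) => x H1 H2 Ox.
  by rewrite (le_trans (ltW r0))//; apply: divr_ge0; apply: ltW; [exact: H2|exact: H1].
have HK s : (r%:E * Kop (hat g) s <= Kop (hat (L g)) s)%E.
  rewrite -(KopZ dw s mhg (@ext0_ge0 _ _ _ _) r0); apply: (le_Kop dw) => //.
  - exact: measurable_funM.
  - by move=> x; rewrite mulr_ge0 ?ext0_ge0.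
  - by move=> x; exact: ext0_ge0.
  apply: (aeS2 (aeI Hr g0) (aeI (ae_ext0 g0) (ae_ext0 Lg0))) => x [H1 H2] [H3 H4].
  have [Ox|Ox] := pselect (O x); last by rewrite !ext0_out ?mulr0.
  by rewrite H3// H4// -ler_pdivlMr ?H2// H1.
apply: (aeS2 (aeI (Kop_Ltilde gg) (Kop_Ltilde ggL)) (aeI (pw_gt0 dw) Lg0)).
move=> x [H1 H2] [H3 H4] Ox; have := HK x.
rewrite H1// H2// -EFinM lee_fin (mulrCA r) ler_pM2l ?H3// => H.
by rewrite ler_pdivlMr ?H4.
Qed.

Lemma ratio_le_Ltilde r : (\forall x \ae mu, O x -> L g x / g x <= r) ->
  \forall x \ae mu, O x -> L (L g) x / L g x <= r.
Proof.
(* Here a negative [r] contradicts the positivity of the given ratio. *)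
move=> Hr; have [r0|r0] := leP 0 r; last first.
  apply: (aeS2 Hr (aeI g0 Lg0)) => x H [H1 H2] Ox; exfalso.
  have : 0 < L g x / g x by rewrite divr_gt0 ?H1 ?H2.
  by rewrite ltNge (le_trans (H Ox))// ltW.
have HK s : (Kop (hat (L g)) s <= r%:E * Kop (hat g) s)%E.
  rewrite -(KopZ dw s mhg (@ext0_ge0 _ _ _ _) r0); apply: (le_Kop dw) => //.
  - exact: measurable_funM.
  - by move=> x; exact: ext0_ge0.
  - by move=> x; rewrite mulr_ge0 ?ext0_ge0.
  apply: (aeS2 (aeI Hr g0) (aeI (ae_ext0 g0) (ae_ext0 Lg0))) => x [H1 H2] [H3 H4].
  have [Ox|Ox] := pselect (O x); last by rewrite !ext0_out ?mulr0.
  by rewrite H3// H4// -ler_pdivrMr ?H2// H1.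
apply: (aeS2 (aeI (Kop_Ltilde gg) (Kop_Ltilde ggL)) (aeI (pw_gt0 dw) Lg0)).
move=> x [H1 H2] [H3 H4] Ox; have := HK x.
rewrite H1// H2// -EFinM lee_fin (mulrCA r) ler_pM2l ?H3// => H.
by rewrite ler_pdivrMr ?H4.
Qed.

End ratio.
End iterates.

(** * Comparison through real bounds, and the conclusion *)

(** An essential supremum may be infinite. Testing it against real [r] reduces every claim to
    almost-everywhere inequalities with a real constant; if x = -oo, every real bounds y, so y =
    -oo. *)
Lemma le_of_real_bounds (R : realType) (x y : \bar R) :
  (forall r : R, (x <= r%:E)%E -> (y <= r%:E)%E) -> (y <= x)%E.
Proof.
case: x => [r H|_|H]; [exact: H|by rewrite leey|].
rewrite leeNy_eq; apply/eqP; case: y H => [s H|H|//].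
  by have := H (s - 1) (leNye _); rewrite lee_fin => h; exfalso; lra.
by have := H 0 (leNye _); rewrite leye_eq.
Qed.

Lemma ge_of_real_bounds (R : realType) (x y : \bar R) :
  (forall r : R, (r%:E <= x)%E -> (r%:E <= y)%E) -> (x <= y)%E.
Proof.
move=> H; rewrite -leeN2; apply: le_of_real_bounds => r.
by rewrite leeNl -EFinN => /H Hr; rewrite leeNl -EFinN.
Qed.
Theorem theorem3p4 (R : realType) (a b : \bar R) (p w g0 : R -> R) :
  (a < b)%E ->
  density_weight a b p w ->
  hypH1 a b p w ->
  hypH2 a b p w ->
  E2 a b p w g0 ->
  (\forall x \ae (@lebesgue_measure R), oitv a b x -> 0 < g0 x) ->
  (forall n : nat, ratio_itv a b p w g0 n.+1 `<=` ratio_itv a b p w g0 n) /\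
  (forall n : nat, ratio_itv a b p w g0 n (poincare_const a b p w)).

Proof.
move=> ab dw hyp1 h2 [x0 [_ L2g _ _]] gpos.
(* An infimum below +oo is the infimum of a nonempty set. *)
have [c0 adm0] : exists c, admissible a b p w c.
  move: hyp1; rewrite /hypH1 /poincare_const => /ereal_inf_lt[_ [c adm _] _].
  by exists c.
have gn n : posL2 a b p w (Ltilde_iter a b p w n g0).
  elim: n => [|n IH]; first exact: (posL2_init dw L2g gpos).
  by rewrite /Ltilde_iter iterS; exact: (posL2_Ltilde ab dw h2 adm0 IH).
split => n; last first.
  rewrite /ratio_itv /=; apply/andP; split.
    (* Every real [r] below the ratio is at most every admissible constant, hence at most their
       infimum. *)
    apply: ge_of_real_bounds => r /ess_infP/ae_mu_on Hr.
    apply: le_ereal_inf_tmp => _ [c adm <-]; rewrite lee_fin.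
    apply: (ratio_ge_admissible ab dw h2 adm0 (gn n) adm).
    by apply: (aeS Hr) => x H Ox; rewrite -lee_fin; exact: H.
  (* Every real [r] above the ratio is itself admissible, so the infimum is at most [r]. *)
  apply: le_of_real_bounds => r /ess_supP/ae_mu_on Hr.
  apply: ereal_inf_lbound; exists r => //.
  apply: (ratio_le_admissible ab dw h2 adm0 (gn n)).
  by apply: (aeS Hr) => x H Ox; rewrite -lee_fin; exact: H.
(* Nesting compares the ends: a real bound for one ratio is a bound for the next. *)
move=> c /andP[c1 c2]; apply/andP; split.
  apply: le_trans c1; apply: ge_of_real_bounds => r /ess_infP/ae_mu_on Hr.
  apply/ess_infP/ae_mu_on.
  have {}Hr : \forall x \ae (@lebesgue_measure R), oitv a b x ->
      r <= Ltilde_iter a b p w n.+1 g0 x / Ltilde_iter a b p w n g0 x.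
    by apply: (aeS Hr) => x H Ox; rewrite -lee_fin; exact: H.
  apply: (aeS (ratio_ge_Ltilde ab dw h2 adm0 (gn n) Hr)) => x H Ox.
  by rewrite lee_fin; exact: H.
apply: (le_trans c2); apply: le_of_real_bounds => r /ess_supP/ae_mu_on Hr.
apply/ess_supP/ae_mu_on.
have {}Hr : \forall x \ae (@lebesgue_measure R), oitv a b x ->
    Ltilde_iter a b p w n.+1 g0 x / Ltilde_iter a b p w n g0 x <= r.
  by apply: (aeS Hr) => x H Ox; rewrite -lee_fin; exact: H.
apply: (aeS (ratio_le_Ltilde ab dw h2 adm0 (gn n) Hr)) => x H Ox.
by rewrite lee_fin; exact: H.
Qed.
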